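(* Let $G=[a_1\times a_2\times\cdots\times a_k]$ be a $k$-dimensional grid ($k\ge 2$) with $a_i\ge 2^{22}$ for each $i$. Then the embedding $H^k:G\to Opt(G)$ constructed in the context satisfies $\mathrm{dilation}(H^k)\le 3k$.
   Context: Basic definitions. The grid $[a_1\times\cdots\times a_k]$ has as vertices the integer $k$-tuples $x=(x_1,\dots,x_k)$ with $1\le x_i\le a_i$, with $x,y$ adjacent iff $\sum_i|x_i-y_i|=1$. $Q_n$ is the graph on all $0/1$ strings of length $n$, two strings being adjacent iff they differ in exactly one coordinate. $Opt(G)=Q_n$ with $n=\lceil\log_2|V(G)|\rceil$ is the smallest hypercube with at least $|V(G)|$ vertices. For a one-to-one map $g:V(G)\to V(H)$, $\mathrm{dilation}(g)=\max\{dist_H(g(x),g(y)):xy\in E(G)\}$, where $dist_H$ is graph distance in $H$. Put $e_0=0$, $e_i=\lceil\log_2(a_1\cdots a_i)\rceil$, $p_i=e_i-e_{i-1}$ (so $p_i\ge 22$ and $p_1+\cdots+p_k=n$), $P_i=a_{i+1}a_{i+2}\cdots a_k$, and $u_i=\lceil |V(G)|/2^{e_{i-1}}\rceil$. The subscript in $f(x)_j$ denotes the $j$-th coordinate. Construction of $H^k$. Maps $f_2,f_3,\dots,f_k$ on $V(G)$ are built in succession. Each $f_i$ takes values in the $i$-tuples $(z_1,\dots,z_i)$ of integers with $1\le z_j\le 2^{p_j}$ for $j<i$ and $1\le z_i\le u_i$. (1) The map $f_2$. Identify $x\in V(G)$ with the pair $(x_1,y)$, where $y=x_2+(x_3-1)a_2+(x_4-1)a_2a_3+\cdots+(x_k-1)a_2a_3\cdots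 a_{k-1}$. Let $R=(R_{ij})$, $1\le i\le a_1$, $j\ge 1$, be the $(0,1)$ matrix with $R_{i1}=\lfloor\frac{2^{e_1}-a_1}{a_1}i\rfloor-\lfloor\frac{2^{e_1}-a_1}{a_1}(i-1)\rfloor$ and $R_{ij}=R_{i-1,j-1}$ for $j>1$, row indices taken modulo $a_1$ in $\{1,\dots,a_1\}$. Put $N_{ij}=j+\sum_{t=1}^jR_{it}$ (with $N_{i0}=0$) and $c_{ij}=i+\sum_{s=1}^iR_{sj}$ (with $c_{0j}=0$). For all $1\le i\le a_1$, $j\ge 1$: if $R_{ij}=0$, then $f(i,N_{i,j-1}+1)=(c_{i-1,j}+1,j)$; if $R_{ij}=1$ and $j$ is odd, then $f(i,N_{i,j-1}+1)=(c_{i-1,j}+1,j)$ and $f(i,N_{i,j-1}+2)=(c_{i-1,j}+2,j)$; if $R_{ij}=1$ and $j$ is even, then $f(i,N_{i,j-1}+1)=(c_{i-1,j}+2,j)$ and $f(i,N_{i,j-1}+2)=(c_{i-1,j}+1,j)$. Then $f_2$ is the restriction of $f$ to $V(G)$ under the identification. (2) From $f_i$ to $f_{i+1}$, for $i=2,\dots,k-1$. Blank levels. For $1\le j\le P_i$ let $s_i(j)=2^{p_i}-\lceil\frac{a_1\cdots a_i}{2^{e_{i-1}}}\rceil+\lfloor j\phi_i\rfloor-\lfloor(j-1)\phi_i\rfloor$, where $\phi_i=\lceil\frac{a_1\cdots a_i}{2^{e_{i-1}}}\rceil-\frac{a_1\cdots a_i}{2^{e_{i-1}}}$. Let $T=(t_{cd})$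 be the $P_i\times 2^{p_i}$ matrix with $t_{cd}=s_i(c)/2^{p_i}$ for all $d$. Let $F(i)=(f_{cd})$ be a $(0,1)$ matrix of the same size that is a rounding of $T$ (each $f_{cd}$ is $\lfloor t_{cd}\rfloor$ or $\lceil t_{cd}\rceil$) with $|\sum_{d=1}^b(t_{cd}-f_{cd})|<1$ for every row $c$ and every $1\le b\le 2^{p_i}$, $|\sum_{c=1}^b(t_{cd}-f_{cd})|<1$ for every column $d$ and every $1\le b\le P_i$, and $|\sum_{c,d}(t_{cd}-f_{cd})|<1$. (Such a rounding exists; one is fixed.) For $1\le c\le P_i$ and $1\le d\le 2^{p_i}$, call the integer $(c-1)2^{p_i}+d$ blank if $f_{cd}=1$ and nonblank if $f_{cd}=0$. There are exactly $u_i$ nonblank integers in $\{1,\dots,P_i2^{p_i}\}$. Inflation. $I_i(z_1,\dots,z_i)=(z_1,\dots,z_{i-1},z_i')$, where $z_i'$ is the $z_i$-th smallest nonblank integer. Stacking. For $y=(y_1,\dots,y_i)\in I_i(f_i(V(G)))$ let $r=\lceil y_i/2^{p_i}\rceil$, let $\bar y_i\in\{1,\dots,2^{p_i}\}$ be congruent to $y_i$ modulo $2^{p_i}$, and let $n_y$ be the number of $z\in I_i(f_i(V(G)))$ with $z_j=y_j$ for $1\le j\le i-1$, $z_i\equiv y_i\pmod{2^{p_i}}$ and $z_i\le r2^{p_i}$. Put $\sigma_i(y)=(y_1,\dots,y_{i-1},\bar y_i,n_y)$. Finally $f_{i+1}=\sigma_i\circ I_i\circ f_i$. (3) Hypercube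 labels. For $t\ge 22$, $Q_t$ has a spanning subgraph consisting of a cycle $x_1,x_2,\dots,x_e$ ($e=2^t/16$) together with exactly 15 leaves $x_{i,1},\dots,x_{i,15}$ attached to each $x_i$. Fix one and define the bijection $L_t:V(Q_t)\to\{1,\dots,2^t\}$ by $L_t(x_i)=16i$ and $L_t(x_{i,j})=16(i-1)+j$. (It has the property that $|L_t(x)-L_t(y)|\le 17$, the difference taken modulo $2^t$, implies $dist_{Q_t}(x,y)\le 3$.) (4) The embedding. One has $1\le f_k(x)_j\le 2^{p_j}$ for all $x\in V(G)$ and $1\le j\le k$, and $f_k$ is one-to-one. $H^k(x)\in V(Q_n)=V(Opt(G))$ is the concatenation, for $j=1,2,\dots,k$ in order, of the strings $L_{p_j}^{-1}(f_k(x)_j)\in V(Q_{p_j})$. *)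

(* Defs.v *)
From mathcomp Require Import all_boot all_order all_algebra.
Set Implicit Arguments.
Unset Strict Implicit.
Unset Printing Implicit Defensive.
Import Order.TTheory GRing.Theory Num.Theory.

(* Graphs are relations on finite types. *)

(* Graph distance: the least n such that a walk of n edges joins x to y.  The
   search stops at #|T|, which is the (junk) value for disconnected vertices;
   hypercubes are connected. *)
Definition gdist (T : finType) (e : rel T) (x y : T) : nat :=
  find (fun n => [exists w : n.-tuple T, path e x w && (last x w == y)])
       (iota 0 #|T|).

Definition dilation (gT hT : finType) (eG : rel gT) (eH : rel hT)
    (g : gT -> hT) : nat :=
  \max_(xy : gT * gT | eG xy.1 xy.2) gdist eH (g xy.1) (g xy.2).

Definition cube (n : nat) : finType := n.-tuple bool.

Definition cube_adj (n : nat) : rel (cube n) :=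
  fun x y => #|[pred i | tnth x i != tnth y i]| == 1.

Definition opt (T : finType) : finType := cube (up_log 2 #|T|).

(* The grid [a_1 x ... x a_k].  Vertices are stored with coordinates shifted
   down by one; [grid_coords] returns the tuple (x_1, ..., x_k), 1 <= x_i <= a_i. *)
Definition grid (k : nat) (a : k.-tuple nat) : finType :=
  {dffun forall i : 'I_k, 'I_(tnth a i)}.

Definition grid_adj (k : nat) (a : k.-tuple nat) : rel (grid a) :=
  fun x y => \sum_(i < k) `|(x i : nat) - (y i : nat)|%N == 1.

Definition grid_coords (k : nat) (a : k.-tuple nat) (x : grid a) : seq nat :=
  [seq (x i).+1 | i : 'I_k].

(* Integer tuples of varying length are sequences, with entries numbered from 1
   (and likewise a_i is [coord a i]). *)
Definition coord (z : seq nat) (i : nat) : nat := nth 0 z i.-1.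

(* a_1 ... a_i, e_i, p_i and P_i. *)
Definition headprod (a : seq nat) (i : nat) : nat := \prod_(m <- take i a) m.
Definition e_ (a : seq nat) (i : nat) : nat := up_log 2 (headprod a i).
Definition p_ (a : seq nat) (i : nat) : nat := e_ a i - e_ a i.-1.
Definition P_ (a : seq nat) (i : nat) : nat := \prod_(m <- drop i a) m.

Definition R1 (a : seq nat) (i : nat) : nat :=
  let a1 := coord a 1 in
  ((2 ^ e_ a 1 - a1) * i) %/ a1 - ((2 ^ e_ a 1 - a1) * i.-1) %/ a1.

Fixpoint R_ (a : seq nat) (i j : nat) : nat :=
  match j with
  | 0 => 0
  | j'.+1 => if j' == 0 then R1 a i
             else R_ a (if i == 1 then coord a 1 else i.-1) j'
  end.

Definition N_ (a : seq nat) (i j : nat) : nat :=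
  j + \sum_(1 <= t < j.+1) R_ a i t.

Definition c_ (a : seq nat) (i j : nat) : nat :=
  i + \sum_(1 <= s < i.+1) R_ a s j.

(* The j with N_{i,j-1} < y <= N_{ij}, for y >= 1. *)
Definition chain_col (a : seq nat) (i y : nat) : nat :=
  find (fun j => y <= N_ a i j) (iota 0 y.+1).

(* The map called f in the construction, on pairs (i, y) with y >= 1; its
   defining rules are [chain_map0], [chain_map_odd] and [chain_map_even]. *)
Definition chain_map (a : seq nat) (i y : nat) : seq nat :=
  let j := chain_col a i y in
  let d := y - N_ a i j.-1 in
  [:: c_ a i.-1 j + (if (R_ a i j == 1) && ~~ odd j then 3 - d else d); j].

Definition f2 (k : nat) (a : k.-tuple nat) (x : grid a) : seq nat :=
  let z := grid_coords x in
  chain_map a (coord z 1)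
    (coord z 2 + \sum_(3 <= j < k.+1)
                   (coord z j - 1) * \prod_(2 <= l < j) coord a l).

Section Blank.
Local Open Scope ring_scope.

Definition ratio_ (a : seq nat) (i : nat) : rat :=
  (headprod a i)%:R / 2 ^+ e_ a i.-1.

Definition phi_ (a : seq nat) (i : nat) : rat :=
  (Num.ceil (ratio_ a i))%:~R - ratio_ a i.

Definition s_ (a : seq nat) (i j : nat) : int :=
  (2 ^ p_ a i)%N%:Z - Num.ceil (ratio_ a i)
  + Num.floor (j%:R * phi_ a i) - Num.floor ((j.-1)%:R * phi_ a i).

(* Matrix indices start at 0. *)
Definition T_ (a : seq nat) (i : nat) : 'M[rat]_(P_ a i, 2 ^ p_ a i) :=
  \matrix_(c, d) ((s_ a i c.+1)%:~R / 2 ^+ p_ a i).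

Definition is_rounding (m n : nat) (T : 'M[rat]_(m, n)) (F : 'M[bool]_(m, n)) :
    Prop :=
  [/\ forall c d, (F c d)%:Z = Num.floor (T c d) \/
                  (F c d)%:Z = Num.ceil (T c d),
      forall (c : 'I_m) (b : nat), (1 <= b <= n)%N ->
        `|\sum_(d < n | (d < b)%N) (T c d - (F c d)%:R)| < 1,
      forall (d : 'I_n) (b : nat), (1 <= b <= m)%N ->
        `|\sum_(c < m | (c < b)%N) (T c d - (F c d)%:R)| < 1
    & `|\sum_(c < m) \sum_(d < n) (T c d - (F c d)%:R)| < 1].

End Blank.

(* The type of the chosen roundings F(i); only 2 <= i < k is used. *)
Definition roundings (a : seq nat) : Type :=
  forall i : nat, 'M[bool]_(P_ a i, 2 ^ p_ a i).

Definition blank (a : seq nat) (F : roundings a) (i m : nat) : bool :=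
  [exists c : 'I_(P_ a i), exists d : 'I_(2 ^ p_ a i),
     (m == c * 2 ^ p_ a i + d.+1) && F i c d].

(* In increasing order. *)
Definition nonblanks (a : seq nat) (F : roundings a) (i : nat) : seq nat :=
  [seq m <- iota 1 (P_ a i * 2 ^ p_ a i) | ~~ blank F i m].

Definition inflate (a : seq nat) (F : roundings a) (i : nat) (z : seq nat) :
    seq nat :=
  rcons (take i.-1 z) (coord (nonblanks F i) (coord z i)).

(* [S] lists the set I_i(f_i(V(G))) without repetition; (y_i + q - 1) %/ q is
   the ceiling of y_i / q. *)
Definition stack (a : seq nat) (i : nat) (S : seq (seq nat)) (y : seq nat) :
    seq nat :=
  let q := 2 ^ p_ a i in
  let r := (coord y i + q - 1) %/ q in
  let ybar := ((coord y i - 1) %% q).+1 in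
  let n := count (fun z => [&& take i.-1 z == take i.-1 y,
                               coord z i == coord y i %[mod q]
                             & coord z i <= r * q]) S in
  rcons (rcons (take i.-1 y) ybar) n.

Definition next_map (k : nat) (a : k.-tuple nat) (F : roundings a) (i : nat)
    (f : grid a -> seq nat) : grid a -> seq nat :=
  let g := fun x => inflate F i (f x) in
  fun x => stack a i (undup (codom g)) (g x).

(* f_i for i >= 2. *)
Fixpoint f_ (k : nat) (a : k.-tuple nat) (F : roundings a) (i : nat) :
    grid a -> seq nat :=
  match i with
  | 0 => @f2 k a
  | j.+1 => if 2 <= j then next_map F j (f_ F j) else @f2 k a
  end.

(* L is the labelling L_t attached to a spanning subgraph of Q_t made of a cycle
   (c i), i < 2^t/16, and 15 leaves (l i j) at each c i.  Here c i is x_(i+1)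
   and l i j is x_(i+1,j+1). *)
Definition is_labelling (t : nat) (L : cube t -> nat) : Prop :=
  exists (c : 'I_(2 ^ t %/ 16) -> cube t)
         (l : 'I_(2 ^ t %/ 16) -> 'I_15 -> cube t),
  [/\ bijective (fun v : 'I_(2 ^ t %/ 16) + 'I_(2 ^ t %/ 16) * 'I_15 =>
                   match v with inl i => c i | inr (i, j) => l i j end),
      forall i, cube_adj (c i) (c (ordS i)),
      forall i j, cube_adj (c i) (l i j),
      forall i, L (c i) = 16 * i.+1
    & forall i j, L (l i j) = 16 * i + j.+1].

(* L_t^-1 (the zero string outside the range of L_t). *)
Definition label_inv (t : nat) (L : cube t -> nat) (m : nat) : cube t :=
  odflt (nseq_tuple t false) [pick x | L x == m].

Definition label_concat (a : seq nat) (k : nat)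
    (L : forall t : nat, cube t -> nat) (z : seq nat) : seq bool :=
  flatten [seq tval (label_inv (L (p_ a j)) (coord z j)) | j <- iota 1 k].

(* The [insubd] only turns the concatenation into a string of the right length:
   see [val_embedding]. *)
Definition embedding (k : nat) (a : k.-tuple nat) (F : roundings a)
    (L : forall t : nat, cube t -> nat) (x : grid a) : opt (grid a) :=
  insubd (nseq_tuple _ false) (label_concat a k L (f_ F k x)).

Lemma N_mono (a : seq nat) (i j j' : nat) : j <= j' -> N_ a i j <= N_ a i j'.
Proof.
move=> le; rewrite /N_ leq_add // (big_cat_nat (n := j.+1) (p := j'.+1)) //=.
exact: leq_addr.
Qed.

Lemma chain_colP (a : seq nat) (i j y : nat) :
  0 < j -> N_ a i j.-1 < y <= N_ a i j -> chain_col a i y = j.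
Proof.
move=> j0 /andP[lo hi]; rewrite /chain_col.
have jy : j <= y.
  by apply: leq_trans lo; rewrite -{1}(prednK j0) ltnS leq_addr.
set P := fun j => _.
have -> : iota 0 y.+1 = iota 0 j ++ iota j (y.+1 - j).
  by rewrite -[in LHS](subnKC (leqW jy)) iotaD.
rewrite find_cat size_iota.
case: ifP => [/hasP[n]|_].
  rewrite mem_iota /= add0n /P => nj yn.
  have := leq_trans (leq_trans lo yn) (N_mono a i (_ : n <= j.-1)).
  by rewrite ltnn => h; have := h; rewrite -ltnS prednK // => /(_ nj).
by rewrite subSn //= /P hi addn0.
Qed.

Lemma N_rec (a : seq nat) (i j : nat) :
  0 < j -> N_ a i j = (N_ a i j.-1 + R_ a i j).+1.
Proof.
by case: j => // j _; rewrite /N_ big_nat_recr //= addSn addnA.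
Qed.

Lemma chain_map0 (a : seq nat) (i j : nat) : 0 < j -> R_ a i j = 0 ->
  chain_map a i (N_ a i j.-1 + 1) = [:: c_ a i.-1 j + 1; j].
Proof.
move=> j0 Rj; rewrite /chain_map (chain_colP (j := j)) //.
  by rewrite Rj /= addKn.
by rewrite (N_rec _ _ j0) Rj addn1 addn0 !leqnn.
Qed.

Lemma chain_map_odd (a : seq nat) (i j d : nat) :
  odd j -> R_ a i j = 1 -> 1 <= d <= 2 ->
  chain_map a i (N_ a i j.-1 + d) = [:: c_ a i.-1 j + d; j].
Proof.
move=> oj Rj /andP[d1 d2].
have j0 : 0 < j by case: j oj {Rj}.
rewrite /chain_map (chain_colP (j := j)) //; first by rewrite Rj oj /= addKn.
by rewrite (N_rec _ _ j0) Rj -addnS leq_add2l d2 andbT -addn1 leq_add2l.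
Qed.

Lemma chain_map_even (a : seq nat) (i j : nat) :
  0 < j -> ~~ odd j -> R_ a i j = 1 ->
  chain_map a i (N_ a i j.-1 + 1) = [:: c_ a i.-1 j + 2; j] /\
  chain_map a i (N_ a i j.-1 + 2) = [:: c_ a i.-1 j + 1; j].
Proof.
move=> j0 oj Rj.
have H d : 1 <= d <= 2 -> chain_col a i (N_ a i j.-1 + d) = j.
  move=> /andP[d1 d2]; apply: chain_colP => //.
  by rewrite (N_rec _ _ j0) Rj -addnS leq_add2l d2 andbT -addn1 leq_add2l.
by split; rewrite /chain_map H // Rj oj /= addKn.
Qed.

Lemma card_grid (k : nat) (a : k.-tuple nat) : #|grid a| = headprod a k.
Proof.
rewrite card_dep_ffun /headprod take_oversize ?size_tuple //.
rewrite -[X in _ = \big[_/_]_(m <- X) m]map_tnth_enum big_map.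
rewrite foldrE big_map big_enum [RHS]big_enum.
by apply: eq_bigr => i _; rewrite card_ord.
Qed.

Lemma e_mono (a : seq nat) (i : nat) :
  all (leq 1) a -> e_ a i <= e_ a i.+1.
Proof.
move=> /allP a1; apply: leq_up_log; rewrite /headprod.
have [lt|ge] := ltnP i (size a); last first.
  by rewrite !take_oversize // leqW.
rewrite (take_nth 0 lt) -cats1 big_cat big_seq1 /=.
by rewrite leq_pmulr // a1 // mem_nth.
Qed.

Lemma sum_p (a : seq nat) (k : nat) :
  all (leq 1) a -> sumn [seq p_ a j | j <- iota 1 k] = e_ a k.
Proof.
move=> a1; elim: k => [|k IHk].
  by rewrite /e_ /headprod take0 big_nil.
rewrite -[k.+1]addn1 iotaD map_cat sumn_cat IHk /= addn0 add1n addn1.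
by rewrite /p_ subnKC ?e_mono.
Qed.

Lemma val_embedding (k : nat) (a : k.-tuple nat) (F : roundings a)
    (L : forall t : nat, cube t -> nat) (x : grid a) :
  all (leq 1) a ->
  tval (embedding F L x) = label_concat a k L (f_ F k x).
Proof.
move=> a1; rewrite /embedding -[LHS]/(val _) insubdK // unfold_in /=.
rewrite card_grid -/(e_ a k) /label_concat size_flatten /shape -map_comp.
rewrite (eq_map (g := p_ a)) ?sum_p //.
by move=> j /=; rewrite size_tuple.
Qed.

(* Main.v *)
Require Import Defs.
From mathcomp Require Import all_boot all_order all_algebra zify ring lra.
Set Implicit Arguments.
Unset Strict Implicit.
Unset Printing Implicit Defensive.
Import Order.TTheory GRing.Theory Num.Theory.
(* [vector] has its own [coord]. *)
Import Defs.

(* Write E_i = 2^(e_i), q = 2^(p_i), h = a_1 ... a_i.  Stage i only touches the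
   last coordinate v of f_i(x): if the v-th nonblank integer is
   X = (c - 1) q + d, then v is replaced by d and by the number l of nonblank
   integers in column d down to row c; no cell is skipped because the image of
   f_i is downward closed in its last coordinate.  The row discrepancy of F(i)
   gives v E_i / h - 2 E_i / h < X < v E_i / h + E_i / h, where E_i / h < 2, and
   its column discrepancy gives v / q - 1 < l < v / q + 2.  So errors do not
   accumulate: along an edge that raises the chain index by D, the last
   coordinate of f_i changes by D a_1 / E_(i-1), up to an error of 4.  As D a_1
   is 0 or some a_1 ... a_n, it is either a multiple of h, which shifts X by a
   multiple of q, or at most E_(i-1); both ways d moves by at most 17 modulo q.
   Labels that close lie in the same star or in stars with adjacent centers, or
   are a center and a leaf two stars further: the Hamming distance is at most 3. *)

(** * Hamming distance and labels *)

(** Stated for sequences rather than cube vertices, so that it adds up over a concatenation of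
    labels. Only positions of [s] are summed, hence the size conditions below. *)
Definition ham (s t : seq bool) : nat :=
  \sum_(i < size s) (nth false s i != nth false t i).

Lemma ham_cons b s c t : ham (b :: s) (c :: t) = (b != c) + ham s t.
Proof. by rewrite /ham big_ord_recl. Qed.

Lemma ham_cat s1 s2 t1 t2 :
  size s1 = size t1 -> ham (s1 ++ s2) (t1 ++ t2) = ham s1 t1 + ham s2 t2.
Proof.
elim: s1 t1 => [|b s1 IHs] [|c t1] //=; first by rewrite {2}/ham big_ord0.
by case=> /IHs eq; rewrite !ham_cons eq addnA.
Qed.

Lemma hamxx s : ham s s = 0.
Proof. by rewrite /ham big1 // => i _; rewrite eqxx. Qed.

Lemma hamC s t : size s = size t -> ham s t = ham t s.
Proof.
by move=> st; rewrite /ham st; apply: eq_bigr => i _; rewrite [_ == nth _ t _]eq_sym.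
Qed.

Lemma ham_triangle t s u :
  size s = size t -> ham s u <= ham s t + ham t u.
Proof.
move=> eq; rewrite /ham -eq -big_split /=; apply: leq_sum => i _.
by case: (nth _ s i) (nth _ t i) (nth _ u i) => [] [] [].
Qed.

Lemma ham_cube n (x y : cube n) : ham x y = #|[pred i | tnth x i != tnth y i]|.
Proof.
rewrite /ham -sum1_card [RHS]big_mkcond /= size_tuple.
by apply: eq_bigr => i _; rewrite inE !(tnth_nth false); case: (_ != _).
Qed.

Lemma cube_adjE n (x y : cube n) : cube_adj x y = (ham x y == 1).
Proof. by rewrite /cube_adj ham_cube. Qed.

Lemma cube_triangle n (y x z : cube n) : ham x z <= ham x y + ham y z.
Proof. by apply: ham_triangle; rewrite !size_tuple. Qed.

(** Flipping one coordinate where [x] and [y] differ gives a neighbour of [x] that is one step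
    closer to [y]. *)
Lemma ham_walk n (x y : cube n) :
  exists2 w, path (@cube_adj n) x w /\ last x w = y & size w = ham x y.
Proof.
move: {2}(ham x y) (erefl (ham x y)) => m; elim: m x => [|m IHm] x xy.
  exists [::] => //; split => //=; apply/eq_from_tnth => i.
  move: xy; rewrite ham_cube => /card0_eq/(_ i).
  by rewrite inE; case: eqP.
have /card_gt0P[i] : 0 < #|[pred i | tnth x i != tnth y i]|.
  by rewrite -ham_cube xy.
rewrite inE => xyi; pose z : cube n := [tuple if j == i then tnth y i else tnth x j | j < n].
have xz : cube_adj x z.
  rewrite /cube_adj -(card1 i); apply/eqP/eq_card => j; rewrite !inE tnth_mktuple.
  by case: (eqVneq j i) => [->|]; rewrite ?eqxx.
have zy : ham z y = m.
  apply/eq_add_S; rewrite -xy !ham_cube [RHS](cardD1 i) inE xyi add1n; congr _.+1.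
  apply: eq_card => j; rewrite !inE tnth_mktuple.
  by case: (eqVneq j i) => [->|]; rewrite ?eqxx.
have [w [pw lw] sw] := IHm z zy.
by exists (z :: w); rewrite /= ?xz ?sw ?zy ?xy.
Qed.

Lemma gdist_cube n (x y : cube n) : gdist (@cube_adj n) x y <= ham x y.
Proof.
have [w [pw lw] <-] := ham_walk x y; rewrite /gdist.
set P := fun m => _; set N := #|cube n|.
(* The search in [gdist] never returns more than [N], so a walk of length at least [N] satisfies the
   bound trivially. *)
have [lt|ge] := ltnP (size w) N; last first.
  by rewrite (leq_trans _ ge) // -[leqRHS](size_iota 0) find_size.
rewrite leqNgt; apply/negP => /(before_find 0); rewrite nth_iota // add0n /P.
by move/existsP; apply; exists (in_tuple w); rewrite /= pw lw eqxx.
Qed.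

(** Distance at most [d] modulo [q]. Multiples of [q] are added on both sides to avoid
    subtraction. *)
Definition cyc_close (q d u w : nat) : Prop :=
  exists b c, u + b * q <= w + c * q + d /\ w + c * q <= u + b * q + d.

(** * Labels at cyclic distance at most 17 *)

Section Label.
Variables (t : nat) (L : cube t -> nat).
Hypotheses (t4 : 4 <= t) (hL : is_labelling L).

(** The cycle of centers is unrolled into a periodic walk indexed by all naturals. In star [n] the
    offset [r = 16] is the center itself and a smaller [r] is a leaf, so the boolean [r < 16] bounds
    the distance to the center. *)
Lemma labelling_center :
  exists ctr : nat -> cube t,
  [/\ forall n, ham (ctr n) (ctr n.+1) <= 1,
      forall n b, ctr (n + b * (2 ^ t %/ 16)) = ctr n
    & forall x, exists n r, [/\ L x = 16 * n + r, 0 < r <= 16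
                             & ham x (ctr n) <= (r < 16)]].
Proof.
have [c [l [[g gK Kg] cc cl Lc Ll]]] := hL.
set M := 2 ^ t %/ 16 in c l g gK Kg cc cl Lc Ll *.
have M0 : 0 < M by rewrite divn_gt0 // (_ : 16 = 2 ^ 4) // leq_exp2l.
exists (fun n => c (Ordinal (ltn_pmod n M0))); split.
- move=> n; set u := Ordinal _; set v := Ordinal _.
  have -> : v = ordS u by apply/val_inj; rewrite /= -addn1 -modnDml addn1.
  by have := cc u; rewrite cube_adjE => /eqP ->.
- by move=> n b; congr c; apply/val_inj; rewrite /= addnC modnMDl.
move=> x; rewrite -(Kg x); case: (g x) => [i|[i j]] /=.
  exists i, 16; rewrite Lc; split=> //; first by rewrite mulnS addnC.
  set u := Ordinal _; have -> : u = i by apply/val_inj; rewrite /= modn_small.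
  by rewrite hamxx.
exists i, j.+1; rewrite Ll; split=> //; first by have := ltn_ord j; lia.
set u := Ordinal _; have -> : u = i by apply/val_inj; rewrite /= modn_small.
rewrite hamC ?size_tuple //; have := cl i j; rewrite cube_adjE => /eqP ->.
by rewrite ltnS ltn_ord.
Qed.

Lemma labelling_close x y : cyc_close (2 ^ t) 17 (L x) (L y) -> ham x y <= 3.
Proof.
have [ctr [step per cov]] := labelling_center.
have q16 : 2 ^ t = 16 * (2 ^ t %/ 16).
  by rewrite mulnC divnK // (_ : 16 = 2 ^ 4) // dvdn_exp2l.
case=> b [d]; rewrite q16; move: (_ %/ _) per => M per.
have [n [r [-> r16 xn]]] := cov x; have [m [s [-> s16 ym]]] := cov y.
(* A multiple of 2^t is a whole number of turns around the cycle and is absorbed into the star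
   index. *)
rewrite -(per _ b) in xn; rewrite -(per _ d) in ym.
have -> : 16 * n + r + b * (16 * M) = 16 * (n + b * M) + r by ring.
have -> : 16 * m + s + d * (16 * M) = 16 * (m + d * M) + s by ring.
move: (n + _) (m + _) xn ym => {per cov n m b d q16} n m xn ym [le1 le2].
have S2 u : ham (ctr u) (ctr u.+2) <= 2.
  rewrite (leq_trans (cube_triangle (ctr u.+1) (ctr u) (ctr u.+2))) //.
  by rewrite (@leq_add _ _ 1 1).
have T (u v : cube t) : ham x y <= ham x u + ham u v + ham v y.
  rewrite (leq_trans (cube_triangle u x y)) // -addnA leq_add2l.
  exact: cube_triangle.
have := T (ctr n) (ctr m); rewrite (hamC (s := ctr m)) ?size_tuple // => {}T.
have [nm|mn|nm] := ltngtP n m.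
(* For stars two apart, 32 + s - r <= 17 forces [r = 16] and [s = 1]: [x] is a center, and the path
   costs 0 + 2 + 1. For adjacent stars it costs at most 1 + 1 + 1. *)
- have [mn|mn] : m = n.+1 \/ m = n.+2 by lia.
    by have := step n; rewrite -mn; lia.
  by have := S2 n; rewrite -mn; lia.
- have [nm|nm] : n = m.+1 \/ n = m.+2 by lia.
    by have := step m; rewrite -nm (hamC (s := ctr m)) ?size_tuple //; lia.
  by have := S2 m; rewrite -nm (hamC (s := ctr m)) ?size_tuple //; lia.
by move: T xn; rewrite nm hamxx; lia.
Qed.

Lemma label_invK m : 0 < m <= 2 ^ t -> L (label_inv L m) = m.
Proof.
move=> /andP[m0 mt]; rewrite /label_inv; case: pickP => [x /eqP //|no].
have [c [l [_ _ _ Lc Ll]]] := hL; set M := 2 ^ t %/ 16 in c l Lc Ll.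
have q16 : 2 ^ t = 16 * M.
  by rewrite mulnC divnK // (_ : 16 = 2 ^ 4) // dvdn_exp2l.
have iM : m.-1 %/ 16 < M by rewrite q16 in mt; lia.
(* The remainder 15 of m - 1 belongs to a center, every smaller remainder to a leaf. *)
have [r15|r15] := ltnP (m.-1 %% 16) 15.
  have /eqP[] := no (l (Ordinal iM) (Ordinal r15)); rewrite Ll /=; lia.
have /eqP[] := no (c (Ordinal iM)); rewrite Lc /=; lia.
Qed.
End Label.

(** * The two-dimensional map *)

Section FloorSteps.
Variables (A B : nat).
Hypothesis A0 : 0 < A.

Definition floor_mul n := (B * n) %/ A.
Local Notation g := floor_mul.

Lemma floor_mul_mono n n' : n <= n' -> g n <= g n'.
Proof. by move=> le; apply: leq_div2r; rewrite leq_mul2l le orbT. Qed.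

Lemma floor_mul_addM n M : g (n + A * M) = g n + B * M.
Proof. by rewrite /g mulnDr mulnCA (mulnC A) divnDMl. Qed.

(** The two remainders modulo [A] differ by less than [A], so over [j] steps the floor rises by B j
    / A up to an error below 1. *)
Lemma floor_mul_bounds n j : A * (g (n + j) - g n) < B * j + A /\
  B * j < A * (g (n + j) - g n) + A.
Proof.
have le := floor_mul_mono (leq_addr j n).
have E1 := divn_eq (B * n) A; have E2 := divn_eq (B * (n + j)) A.
have l1 := ltn_pmod (B * n) A0; have l2 := ltn_pmod (B * (n + j)) A0.
rewrite -!/(g _) in E1 E2; rewrite mulnBr; move: (_ %% _) (_ %% _) E1 E2 l1 l2 le.
move: (g n) (g (n + j)) => u v r s; rewrite mulnDr.
move=> -> E l1 l2 le; have leA := leq_mul (leqnn A) le; lia.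
Qed.

End FloorSteps.

(** * The matrix R and its chains *)

Section Chains.
Variables (a : seq nat) (A m : nat).
Hypotheses (AE : coord a 1 = A) (mE : 2 ^ e_ a 1 = m).
Hypotheses (A0 : 0 < A) (Am : A <= m) (m2A : m < 2 * A).

Local Notation g := (floor_mul A (m - A)).
Let g_mono := @floor_mul_mono A (m - A).
Let g_bounds := floor_mul_bounds (m - A) A0.

(** R is constant along cyclic diagonals, so its entry is the increment of [g] from i - j to i - j +
    1. Increments of [g] have period [A]; the shift [A * M] only keeps the argument nonnegative. *)
Lemma R_floor_mul i j M : 0 < i <= A -> 0 < j <= i + A * M ->
  R_ a i j = g (i + A * M + 1 - j) - g (i + A * M - j).
Proof.
elim: j i M => // j IHj i M iA jM; case: j => [|j] in IHj jM *.
  rewrite /= /R1 AE mE -/(g _) -/(g _).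
  have -> : i + A * M + 1 - 1 = i + A * M by lia.
  have -> : i + A * M - 1 = i.-1 + A * M by lia.
  rewrite !floor_mul_addM //; lia.
have -> : R_ a i j.+2 = R_ a (if i == 1 then A else i.-1) j.+1 by rewrite -AE.
case: (eqVneq i 1) => i1.
  case: M jM => [|M] jM; first by lia.
  rewrite (IHj _ M); [|lia|lia]; congr (g _ - g _); lia.
rewrite (IHj _ M); [|lia|lia]; congr (g _ - g _); lia.
Qed.

Lemma R_le1 i j : 0 < i <= A -> 0 < j -> R_ a i j <= 1.
Proof.
move=> iA j0; rewrite (@R_floor_mul i j j) //; last by nia.
have -> : i + A * j + 1 - j = i + A * j - j + 1 by nia.
have [+ _] := g_bounds (i + A * j - j) 1; nia.
Qed.

(** Along a row the diagonal index runs backwards from i to i - j, so the row sum telescopes and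
    N_ij is within 1 of j m / A. *)
Lemma N_bounds i j : 0 < i <= A ->
  A * N_ a i j < m * j + A /\ m * j < A * N_ a i j + A.
Proof.
move=> iA.
have jA : j <= i + A * j by nia.
suff E M : j <= i + A * M ->
    \sum_(1 <= t < j.+1) R_ a i t = g (i + A * M) - g (i + A * M - j).
  have := g_bounds (i + A * j - j) j; rewrite subnK // -E // /N_; nia.
elim: j {jA} => [|j IHj] jM.
  by rewrite big_geq // subn0 subnn.
rewrite big_nat_recr // IHj 1?ltnW // (@R_floor_mul _ _ M) //.
have -> : i + A * M + 1 - j.+1 = i + A * M - j by lia.
have : g (i + A * M - j) <= g (i + A * M) by apply: g_mono; lia.
have : g (i + A * M - j.+1) <= g (i + A * M - j) by apply: g_mono; lia.
by move=> *; rewrite [LHS]addnC; lia.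
Qed.

(** Down a column the diagonal index runs forwards from 1 - j, and the sum telescopes again. *)
Lemma c_bounds i j : i <= A -> 0 < j ->
  A * c_ a i j < m * i + A /\ m * i < A * c_ a i j + A.
Proof.
move=> iA j0.
suff E : \sum_(1 <= s < i.+1) R_ a s j = g (A * j + 1 - j + i) - g (A * j + 1 - j).
  have := g_bounds (A * j + 1 - j) i; rewrite -E /c_; nia.
elim: i iA => [|i IHi] iA; first by rewrite big_geq // addn0 subnn.
rewrite big_nat_recr // IHi 1?ltnW // (@R_floor_mul _ _ j) //; last by nia.
have -> : i.+1 + A * j + 1 - j = A * j + 1 - j + i.+1 by nia.
have -> : i.+1 + A * j - j = A * j + 1 - j + i by nia.
have : g (A * j + 1 - j) <= g (A * j + 1 - j + i) by apply: g_mono; lia.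
have : g (A * j + 1 - j + i) <= g (A * j + 1 - j + i.+1) by apply: g_mono; lia.
by move=> *; rewrite [LHS]addnC; lia.
Qed.

Lemma c_top j : 0 < j -> c_ a A j = m.
Proof. by move=> j0; have := c_bounds (leqnn A) j0; nia. Qed.

Lemma c_rec i j : 0 < i -> c_ a i j = (c_ a i.-1 j + R_ a i j).+1.
Proof.
by case: i => // i _; rewrite /c_ big_nat_recr //= addSn addnA.
Qed.

Lemma c0 j : c_ a 0 j = 0.
Proof. by rewrite /c_ big_geq. Qed.

Lemma c_mono i i' j : i <= i' -> c_ a i j <= c_ a i' j.
Proof.
move=> le; rewrite -(subnK le); elim: (i' - i) => // d IHd.
by have := c_rec j (ltn0Sn (d + i)); rewrite addSn succnK; lia.
Qed.

Lemma chain_colE i y : 0 < y ->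
  0 < chain_col a i y /\ N_ a i (chain_col a i y).-1 < y <= N_ a i (chain_col a i y).
Proof.
move=> y0; have h : has (fun j => y <= N_ a i j) (iota 0 y.+1).
  (* N_iy >= y, so the search stops at column [y] at the latest. *)
  by apply/hasP; exists y; rewrite ?mem_iota ?ltnSn //= leq_addr.
have := nth_find 0 h; rewrite -/(chain_col a i y).
have lt : chain_col a i y < y.+1 by rewrite -(size_iota 0 y.+1) -has_find.
rewrite nth_iota // add0n => yN; rewrite yN andbT.
have c0 : 0 < chain_col a i y.
  by case: (chain_col a i y) yN => //; rewrite /N_ big_geq // addn0; lia.
split=> //; rewrite ltnNge.
have /(before_find 0) : (chain_col a i y).-1 < chain_col a i y by rewrite prednK.
by rewrite nth_iota ?add0n => [->|]; lia.
Qed.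

(* The second entry of a pair goes first in even columns. *)
Definition chain_flip (i j d : nat) := if (R_ a i j == 1) && ~~ odd j then 3 - d else d.

Lemma chain_flipP i j d : 0 < i <= A -> 0 < j -> 0 < d <= (R_ a i j).+1 ->
  0 < chain_flip i j d <= (R_ a i j).+1 /\ chain_flip i j (chain_flip i j d) = d.
Proof.
move=> iA j0; have := R_le1 iA j0; rewrite /chain_flip.
by case: ifP => [/andP[/eqP-> _]|_]; lia.
Qed.

Lemma chain_mapE i y : chain_map a i y =
  [:: c_ a i.-1 (chain_col a i y) +
      chain_flip i (chain_col a i y) (y - N_ a i (chain_col a i y).-1);
      chain_col a i y].
Proof. by []. Qed.

Lemma chain_map_range i y z v : 0 < i <= A -> 0 < y -> chain_map a i y = [:: z; v] ->
  [/\ 0 < v, N_ a i v.-1 < y <= N_ a i v & c_ a i.-1 v < z <= c_ a i v].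
Proof.
rewrite chain_mapE => iA y0 [zE vE]; have [] := chain_colE i y0; rewrite vE in zE * => v0 yN.
split=> //; have yr : 0 < y - N_ a i v.-1 <= (R_ a i v).+1.
  by move: yN; rewrite (N_rec a i v0); lia.
have [fr _] := chain_flipP iA v0 yr; have := @c_rec i v; lia.
Qed.

(** The intervals from c_(i-1)v + 1 to c_iv of distinct chains are disjoint, so the image determines
    [i]; within one interval the flip is an involution. *)
Lemma chain_map_inj i i' y y' : 0 < i <= A -> 0 < i' <= A -> 0 < y -> 0 < y' ->
  chain_map a i y = chain_map a i' y' -> i = i' /\ y = y'.
Proof.
move=> iA i'A y0 y'0 E.
have [v0 yN zc] := chain_map_range iA y0 (chain_mapE i y).
have [_ yN' zc'] := chain_map_range i'A y'0 (etrans (esym E) (chain_mapE i y)).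
rewrite !chain_mapE in E; case: E => zE vE; rewrite -vE in zE.
move: (chain_col a i y) v0 yN zc zE yN' zc' {vE} => v v0 yN zc zE yN' zc'.
have ii' : i = i'.
  have [lt|lt|//] := ltngtP i i'.
    have : c_ a i v <= c_ a i'.-1 v by apply: c_mono; lia.
    by move: zc zc'; lia.
  have : c_ a i' v <= c_ a i.-1 v by apply: c_mono; lia.
  by move: zc zc'; lia.
split=> //; rewrite -ii' in zE yN'.
have yr : 0 < y - N_ a i v.-1 <= (R_ a i v).+1.
  by move: yN; rewrite (N_rec a i v0); lia.
have yr' : 0 < y' - N_ a i v.-1 <= (R_ a i v).+1.
  by move: yN'; rewrite (N_rec a i v0); lia.
have [_ f1] := chain_flipP iA v0 yr; have [_ f2] := chain_flipP iA v0 yr'.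
suff : y - N_ a i v.-1 = y' - N_ a i v.-1 by lia.
by rewrite -f1 -f2; congr chain_flip; lia.
Qed.

(** Since c_Av = m, the intervals of the chains cover 1, ..., m; the chain through (z, v) is the
    least [i] with z <= c_iv. This serves the downward closure of the image of f_2. *)
Lemma chain_map_surj z v : 0 < z <= m -> 0 < v ->
  exists i y, [/\ 0 < i <= A, N_ a i v.-1 < y <= N_ a i v & chain_map a i y = [:: z; v]].
Proof.
move=> zm v0; have ex : exists i, z <= c_ a i v by exists A; rewrite c_top //; lia.
case: (ex_minnP ex) => i zi imin.
have iA : 0 < i <= A.
  apply/andP; split; last by apply: imin; rewrite c_top //; lia.
  by case: i zi {imin} => //; rewrite c0; lia.
have ci : c_ a i.-1 v < z.
  by rewrite ltnNge; apply/negP => /imin; lia.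
have dr : 0 < z - c_ a i.-1 v <= (R_ a i v).+1.
  by move: zi; rewrite c_rec; lia.
have [fr ff] := chain_flipP iA v0 dr.
exists i, (N_ a i v.-1 + chain_flip i v (z - c_ a i.-1 v)).
have yN : N_ a i v.-1 < N_ a i v.-1 + chain_flip i v (z - c_ a i.-1 v) <= N_ a i v.
  by rewrite (N_rec a i v0); lia.
split=> //; rewrite chain_mapE (chain_colP v0 yN) addKn ff.
by congr [:: _; _]; lia.
Qed.

Lemma chain_map_bounds i y z v : 0 < i <= A -> 0 < y -> chain_map a i y = [:: z; v] ->
  [/\ m * v < A * y + m, A * y < m * v + A, m * i < A * z + m & A * z < m * i + A].
Proof.
move=> iA y0 E; have [v0 /andP[yN Ny] /andP[zc cz]] := chain_map_range iA y0 E.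
have [Nb _] := N_bounds v iA; have [_ Nb1] := N_bounds v.-1 iA.
have iA1 : i <= A by lia.
have iA2 : i.-1 <= A by lia.
have [cb _] := c_bounds iA1 v0; have [_ cb1] := c_bounds iA2 v0.
have vE : m * v = m * v.-1 + m by rewrite -{1}(prednK v0) mulnS addnC.
have iE : m * i = m * i.-1 + m by rewrite -{1}(prednK (proj1 (andP iA))) mulnS addnC.
have := leq_mul (leqnn A) yN; have := leq_mul (leqnn A) Ny.
have := leq_mul (leqnn A) zc; have := leq_mul (leqnn A) cz.
rewrite !mulnS; split; lia.
Qed.

Lemma chain_map_near i i' y D z z' v v' :
  0 < i <= A -> 0 < i' <= A -> i' = i \/ i' = i.+1 -> 0 < y ->
  chain_map a i y = [:: z; v] -> chain_map a i' (y + D) = [:: z'; v'] ->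
  [/\ cyc_close m 17 z z', m * v' <= D * A + m * v + 4 * m &
      D * A + m * v <= m * v' + 4 * m].
Proof.
move=> iA i'A ii' y0 Ez Ez'; have y'0 : 0 < y + D by lia.
have [v1 v2 z1 z2] := chain_map_bounds iA y0 Ez.
have [v1' v2' z1' z2'] := chain_map_bounds i'A y'0 Ez'.
rewrite mulnDr (mulnC A D) in v1' v2'; split; [|lia|lia].
have iE : m * i <= m * i' <= m * i + m.
  by case: ii' => ->; rewrite ?mulnS; lia.
(* The change is below 2 m / A + 1 < 5; 17 is the tolerance shared by all coordinates. *)
have le1 : A * z' < A * (z + 17) by rewrite mulnDr; lia.
have le2 : A * z < A * (z' + 17) by rewrite mulnDr; lia.
rewrite !ltn_pmul2l // in le1 le2.
by exists 0, 0; rewrite !mul0n !addn0; lia.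
Qed.

End Chains.

(** * The grid as rows and chains *)

Section MixedRadix.
Variable b : nat -> nat.

(** A mixed radix number with least significant digit [u 2]: the first grid coordinate selects the
    chain and is not a digit. *)
Definition mixed (u : nat -> nat) n := \sum_(2 <= j < n) u j * \prod_(2 <= l < j) b l.

Lemma mixed_rec u n : 2 <= n -> mixed u n.+1 = mixed u n + u n * \prod_(2 <= l < n) b l.
Proof. by move=> n2; rewrite /mixed big_nat_recr. Qed.

Lemma mixed_lt u n : 2 <= n -> (forall j, 2 <= j < n -> u j < b j) ->
  mixed u n < \prod_(2 <= l < n) b l.
Proof.
elim: n => // n IHn; rewrite leq_eqVlt => /predU1P[<- _|n2 ub].
  by rewrite /mixed !big_geq.
rewrite mixed_rec // big_nat_recr //= mulnC.
have IH : mixed u n < \prod_(2 <= l < n) b l.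
  by apply: IHn => // j /andP[j2 jn]; apply: ub; rewrite j2 ltnW.
have un : u n < b n by apply: ub; lia.
have := leq_mul (leqnn (\prod_(2 <= l < n) b l)) un; rewrite mulnS; lia.
Qed.

Lemma mixed_inj u w n : 2 <= n ->
  (forall j, 2 <= j < n -> u j < b j) -> (forall j, 2 <= j < n -> w j < b j) ->
  mixed u n = mixed w n -> forall j, 2 <= j < n -> u j = w j.
Proof.
elim: n => // n IHn; rewrite leq_eqVlt => /predU1P[<- _ _ _ j|n2 ub wb].
  by lia.
have ub' j : 2 <= j < n -> u j < b j by move=> jn; apply: ub; lia.
have wb' j : 2 <= j < n -> w j < b j by move=> jn; apply: wb; lia.
have ltu := mixed_lt n2 ub'; have ltw := mixed_lt n2 wb'.
rewrite !mixed_rec // => E.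
have B0 : 0 < \prod_(2 <= l < n) b l by apply: leq_trans ltu.
have unw : u n = w n.
  (* The lower digits amount to less than the place value, so the quotient is the top digit. *)
  have := congr1 (fun x => x %/ \prod_(2 <= l < n) b l) E.
  by rewrite !(addnC (mixed _ n)) !divnMDl // !divn_small // !addn0.
move: E; rewrite unw => /addIn /(IHn n2 ub' wb') H j jn.
by have [->|jn'] := eqVneq j n; last apply: H; lia.
Qed.

End MixedRadix.

(** * Grid coordinates and oriented edges *)

Section Grid.
Variables (k : nat) (a : k.-tuple nat).
Hypotheses (hk : 2 <= k) (ha : forall i : 'I_k, 0 < tnth a i).

Lemma coord_gt0 j : 0 < j <= k -> 0 < coord a j.
Proof.
move=> jk; have lt : j.-1 < k by lia.
by have := ha (Ordinal lt); rewrite (tnth_nth 0).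
Qed.

Lemma headprodE n : n <= k -> headprod a n = \prod_(1 <= l < n.+1) coord a l.
Proof.
move=> nk; rewrite /headprod (big_nth 0) size_take size_tuple big_add1 /=.
have -> : (if n < k then n else k) = n by case: ltnP => //; lia.
by apply: eq_big_nat => i /andP[_ ?]; rewrite nth_take.
Qed.

Lemma headprodS n : n < k -> headprod a n.+1 = headprod a n * coord a n.+1.
Proof. by move=> nk; rewrite (headprodE nk) (headprodE (ltnW nk)) big_nat_recr. Qed.

Lemma headprod1 : headprod a 1 = coord a 1.
Proof. by rewrite headprodE 1?ltnW // big_nat1. Qed.

Lemma headprod_P n : headprod a n * P_ a n = headprod a k.
Proof.
by rewrite /headprod /P_ -big_cat /= cat_take_drop take_oversize ?size_tuple.
Qed.

Lemma headprod_gt0 n : 0 < headprod a n.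
Proof.
rewrite /headprod big_seq prodn_cond_gt0 // => m /mem_take /tnthP[i ->].
exact: ha.
Qed.

Lemma headprod_dvd n n' : n <= n' -> headprod a n %| headprod a n'.
Proof.
move=> le; rewrite /headprod -(cat_take_drop n (take n' a)) big_cat /=.
by rewrite take_takel // dvdn_mulr.
Qed.

Lemma headprodE2 n : 0 < n <= k ->
  headprod a n = (\prod_(2 <= l < n.+1) coord a l) * coord a 1.
Proof.
by move=> /andP[n0 nk]; rewrite headprodE // (big_ltn (m := 1)) // mulnC.
Qed.

Definition row_index (x : grid a) := coord (grid_coords x) 1.
(** The number y in the identification of x with (x_1, y). All digits, that of x_2 included, are
    lowered by one, and one is added to the total. *)
Definition chain_index (x : grid a) :=
  (mixed (coord a) (fun j => (coord (grid_coords x) j).-1) k.+1).+1.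

Lemma chain_index_gt0 (x : grid a) : 0 < chain_index x.
Proof. by []. Qed.

Lemma grid_coordE (x : grid a) (i : 'I_k) : coord (grid_coords x) i.+1 = (x i).+1.
Proof.
rewrite /coord /grid_coords (nth_map i) ?size_enum_ord ?ltn_ord //=.
by rewrite nth_ord_enum.
Qed.

Lemma grid_coord_bounds (x : grid a) j :
  0 < j <= k -> 0 < coord (grid_coords x) j <= coord a j.
Proof.
move=> jk; have lt : j.-1 < k by lia.
have := grid_coordE x (Ordinal lt); rewrite /= prednK; last by lia.
by move=> ->; have := ltn_ord (x (Ordinal lt)); rewrite {2}(tnth_nth 0).
Qed.

Lemma f2E (x : grid a) : f2 x = chain_map a (row_index x) (chain_index x).
Proof.
rewrite /f2 -/(row_index x) /chain_index /mixed (big_ltn (m := 2)) //.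
rewrite [X in _ * X]big_geq // muln1 -addSn prednK; last first.
  by have := @grid_coord_bounds x 2; lia.
congr (chain_map a _ (_ + _)); apply: eq_bigr => j _; by rewrite subn1.
Qed.

Lemma row_index_bounds x : 0 < row_index x <= coord a 1.
Proof. by apply: grid_coord_bounds; lia. Qed.

Let digit_lt (x : grid a) j : 2 <= j < k.+1 -> (coord (grid_coords x) j).-1 < coord a j.
Proof. by move=> jk; have := @grid_coord_bounds x j; lia. Qed.

Lemma chain_index_le x : chain_index x <= P_ a 1.
Proof.
have lt := mixed_lt (leqW hk) (@digit_lt x).
apply: leq_trans lt _; rewrite leq_eqVlt; apply/orP; left.
have := headprod_P 1; rewrite headprod1 headprodE2 ?leqnn ?(ltnW hk) // mulnC.
by move/eqP; rewrite eqn_pmul2r 1?eq_sym // coord_gt0 //; lia.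
Qed.

Lemma grid_index_inj x x' :
  row_index x = row_index x' -> chain_index x = chain_index x' -> x = x'.
Proof.
move=> E1 [E2]; apply/ffunP => i; apply/val_inj/eq_add_S.
rewrite -!grid_coordE; have [i0|i0] := posnP i; first by rewrite i0.
have ik := ltn_ord i; have i2 : 2 <= i.+1 < k.+1 by lia.
have := mixed_inj (leqW hk) (@digit_lt x) (@digit_lt x') E2 i2.
have := @grid_coord_bounds x i.+1; have := @grid_coord_bounds x' i.+1; lia.
Qed.

(** By counting: the pair of indices is injective into a set of a_1 P_1 = |V(G)| elements. *)
Lemma grid_index_surj i y : 0 < i <= coord a 1 -> 0 < y <= P_ a 1 ->
  exists x, row_index x = i /\ chain_index x = y.
Proof.
move=> ia yP.
have lt1 x : (row_index x).-1 < coord a 1 by have := row_index_bounds x; lia.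
pose f x : 'I_(coord a 1) * 'I_(P_ a 1) := (Ordinal (lt1 x), Ordinal (chain_index_le x)).
have f_inj : injective f.
  move=> x x' [E1 E2]; apply: grid_index_inj; last by rewrite /chain_index E2.
  by have := row_index_bounds x; have := row_index_bounds x'; lia.
have i1 : i.-1 < coord a 1 by lia.
have y1 : y.-1 < P_ a 1 by lia.
have card : #|{: 'I_(coord a 1) * 'I_(P_ a 1)}| <= #|grid a|.
  by rewrite card_grid card_prod !card_ord -headprod1 headprod_P.
have /codomP[x [E1 E2]] := inj_card_onto f_inj card (Ordinal i1, Ordinal y1).
by exists x; split; last rewrite /chain_index -E2; have := row_index_bounds x; lia.
Qed.

(** An edge oriented upwards, so that the chain index grows by a natural number. *)
Definition grid_up (x x' : grid a) (t : 'I_k) := forall i, x' i = x i + (i == t) :> nat.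

Lemma grid_adj_up x x' : grid_adj x x' -> exists t, grid_up x x' t \/ grid_up x' x t.
Proof.
move=> /eqP E; have [t xt] : exists t, x t != x' t.
  apply/existsP; rewrite -negb_forall; apply/negP => /forallP eq; move: E.
  by rewrite big1 // => i _; rewrite (eqP (eq i)) distnn.
exists t; move: E; rewrite (bigD1 t) //=; set s := \sum_(_ | _) _ => E.
have d0 : 0 < `|(x t : nat) - (x' t : nat)|%N by rewrite lt0n distn_eq0.
have s0 : s = 0 by move: E d0; move: (absz _) s => d s0; rewrite -[LHS]/(d + s0)%N; lia.
have xi i : i != t -> x i = x' i :> nat.
  move=> it; move/eqP: s0; rewrite sum_nat_eq0 => /forall_inP /(_ i it).
  by rewrite distn_eq0 => /eqP.
rewrite s0 [LHS]addn0 in E.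
have [lt|le] := ltnP (x t) (x' t); [left|right] => i.
  rewrite distnEr ?(ltnW lt) // in E.
  by have [->|/xi ->] := eqVneq i t; rewrite ?addn0 //= -E subnKC // ltnW.
rewrite distnEl // in E.
by have [->|/xi ->] := eqVneq i t; rewrite ?addn0 //= -E subnKC.
Qed.

(** For [t = 0] the edge passes to the next chain and D = 0. Otherwise one digit grows by 1, so D is
    its place value a_2 ... a_t, and D a_1 = a_1 ... a_t. *)
Lemma grid_up_index x x' t : grid_up x x' t -> exists D,
  [/\ row_index x' = row_index x \/ row_index x' = (row_index x).+1,
      chain_index x' = chain_index x + D
    & D * coord a 1 = 0 \/ exists2 n, n < k & D * coord a 1 = headprod a n].
Proof.
move=> xx'; have tk := ltn_ord t.
have cE j : 0 < j <= k ->
    coord (grid_coords x') j = coord (grid_coords x) j + (j == t.+1).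
  move=> /andP[j0 jk]; have lt : j.-1 < k by lia.
  have := grid_coordE x (Ordinal lt); have := grid_coordE x' (Ordinal lt).
  rewrite /= prednK // xx' => -> ->; rewrite -val_eqE /= addSn.
  by congr (_ + nat_of_bool _).+1; rewrite -eqSS prednK.
have rE := cE 1 (ltnW hk); rewrite -!/(row_index _) in rE.
have [t0|t0] := posnP t.
  exists 0; split; [by right; rewrite rE t0 addn1| |by left].
  rewrite addn0; congr _.+1; apply: eq_big_nat => j j2.
  rewrite cE; last by lia.
  by rewrite t0 gtn_eqF ?addn0 //; case/andP: j2.
exists (\prod_(2 <= l < t.+1) coord a l); split.
- by left; rewrite rE; lia.
- rewrite /chain_index addSn; congr _.+1; rewrite /mixed.
  have -> : \prod_(2 <= l < t.+1) coord a l =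
      \sum_(2 <= j < k.+1) (j == t.+1) * \prod_(2 <= l < j) coord a l.
    have tI : (t : nat).+1 \in index_iota 2 k.+1.
      by rewrite mem_index_iota !ltnS t0 tk.
    rewrite [RHS](bigD1_seq _ tI (iota_uniq _ _)) /= eqxx mul1n.
    by rewrite [X in _ + X]big1 ?addn0 // => j /negPf ->.
  rewrite -big_split /=; apply: eq_big_nat => j j2; rewrite -mulnDl cE; last by lia.
  by congr (_ * _); have := @grid_coord_bounds x j; lia.
by right; exists t => //; rewrite headprodE2 //; lia.
Qed.
End Grid.

(** * Stacking balanced rows and columns *)

Section FilterIota.
Variables (p : pred nat) (N : nat).

Lemma filter_iota_split n : n < N -> p n ->
  filter p (iota 0 N) = filter p (iota 0 n) ++ n :: filter p (iota n.+1 (N - n.+1)).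
Proof.
move=> nN pn; have {1}-> : N = n + (N - n.+1).+1 by lia.
by rewrite iotaD filter_cat /= pn.
Qed.

Lemma nth_filter_iota n : n < N -> p n ->
  nth 0 (filter p (iota 0 N)) (count p (iota 0 n)) = n.
Proof.
move=> nN pn; rewrite (filter_iota_split nN pn) nth_cat size_filter ltnn.
by rewrite subnn.
Qed.

Lemma count_iota_lt n : n < N -> p n -> count p (iota 0 n) < count p (iota 0 N).
Proof.
move=> nN pn; rewrite -(size_filter p (iota 0 N)) (filter_iota_split nN pn).
by rewrite size_cat size_filter /= addnS ltnS leq_addr.
Qed.

(** Selection followed by ranking, the converse of [nth_filter_iota]. *)
Lemma nth_filter_iotaP i : i < count p (iota 0 N) ->
  let n := nth 0 (filter p (iota 0 N)) i in
  [/\ n < N, p n & count p (iota 0 n) = i].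
Proof.
move=> iN n; have : n \in filter p (iota 0 N) by rewrite mem_nth ?size_filter.
rewrite mem_filter mem_iota /= add0n => /andP[pn nN]; split=> //.
have u : uniq (filter p (iota 0 N)) by rewrite filter_uniq ?iota_uniq.
have := nth_filter_iota nN pn; rewrite -[RHS]/(nth 0 _ i) => /eqP.
by rewrite nth_uniq ?size_filter ?count_iota_lt // => /eqP.
Qed.
End FilterIota.

Lemma count_iota_mono (p : pred nat) n N :
  n <= N -> count p (iota 0 n) <= count p (iota 0 N).
Proof. by move=> le; rewrite -(subnKC le) iotaD count_cat leq_addr. Qed.

(** * The row totals C(b) = ceil(b h / E) *)

Section Levels.
Variables (E h : nat) (C : nat -> nat).
Hypothesis hC : forall b, b * h <= E * C b < b * h + E.

Lemma levels_mono b b' : b <= b' -> C b <= C b'.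
Proof.
move=> le; rewrite leqNgt; apply/negP => lt.
have := hC b; have := hC b'; have := leq_mul (leqnn E) lt.
by have := leq_mul le (leqnn h); rewrite mulnS; lia.
Qed.

Lemma levels0 : C 0 = 0.
Proof.
have := hC 0; rewrite mul0n add0n => /andP[_]; case: (C 0) => // n.
by rewrite mulnS; lia.
Qed.

End Levels.

(** * Columns and heights in an array balanced by rows and columns *)

Section Rows.
Variables (nb : pred nat) (q P E h : nat) (C : nat -> nat).
Hypotheses (q0 : 0 < q) (E0 : 0 < E) (hEq : h <= E * q).
Hypothesis hC : forall b, b * h <= E * C b < b * h + E.
Hypothesis hrow : forall c b, c < P -> b <= q ->
  q * count nb (iota (c * q) b) < b * (C c.+1 - C c) + q /\
  b * (C c.+1 - C c) < q * count nb (iota (c * q) b) + q.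
Hypothesis hcol : forall d b, d < q -> b <= P ->
  q * count (fun c => nb (c * q + d)) (iota 0 b) < C b + q /\
  C b < q * count (fun c => nb (c * q + d)) (iota 0 b) + q.

(** E C(b + 1) < b h + h + E <= E (C(b) + q + 1), because h <= E q. *)
Lemma levels_step b : C b.+1 <= C b + q.
Proof.
rewrite -(leq_pmul2l E0) mulnDr; have := hC b; have := hC b.+1.
have lt : E * C b.+1 < E * (C b + q.+1) -> C b.+1 < C b + q.+1.
  by rewrite ltn_pmul2l.
rewrite mulSn => h1 h2; rewrite -mulnDr leq_pmul2l //.
by move: lt; rewrite addnS ltnS; apply; rewrite -addnS mulnDr mulnS; lia.
Qed.

(** For a full row the discrepancy is an integer of absolute value below 1, hence 0: row c holds
    exactly C(c + 1) - C(c) nonblank cells. *)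
Lemma rank_row c : c <= P -> count nb (iota 0 (c * q)) = C c.
Proof.
elim: c => [|c IHc] cP; first by rewrite mul0n (levels0 hC).
rewrite mulSnr iotaD count_cat IHc ?(ltnW cP) // add0n.
have := hrow cP (leqnn q); rewrite -!mulnSr !ltn_pmul2l //.
by have := levels_mono hC (leqnSn c); lia.
Qed.

Section Position.
Variable n : nat.
Hypotheses (nP : n < P * q) (nbn : nb n).
Let c := n %/ q.
Let d := n %% q.
Let v := (count nb (iota 0 n)).+1.

(** The value of n_y when all nonblank cells of the column down to that of [n] are occupied. *)
Definition stack_height := count (fun c => nb (c * q + n %% q)) (iota 0 (n %/ q).+1).
Let l := stack_height.

Let cP : c < P.
Proof. by rewrite ltn_divLR. Qed.

Let dq : d < q.
Proof. exact: ltn_pmod. Qed.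

Let vE : v = C c + count nb (iota (c * q) d.+1).
Proof.
rewrite -(rank_row (ltnW cP)) -{2}[c * q]add0n -count_cat -iotaD.
by rewrite addnS -divn_eq -addn1 iotaD count_cat /= nbn /v addn1.
Qed.

Lemma level_row : C c < v <= C c.+1.
Proof.
apply/andP; split; last first.
  rewrite -(rank_row cP) /v; apply: count_iota_lt nbn.
  by rewrite mulSnr [ltnLHS](divn_eq n q) ltn_add2l.
rewrite /v ltnS -(rank_row (ltnW cP)); apply: count_iota_mono.
exact: leq_divM.
Qed.

(* With b = d + 1, E q v - h (n + 1) is (q - b) u_c + b u_(c+1) plus E times the
   row discrepancy, where u_c = E C(c) - c h lies in [0, E). *)
Lemma level_position :
  h * n.+1 < E * q * v + E * q /\ E * q * v < h * n.+1 + 2 * (E * q).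
Proof.
have [r1 r2] := hrow cP dq; have le := levels_mono hC (leqnSn c).
have /andP[u0 u0'] := hC c; have /andP[u1 u1'] := hC c.+1.
have -> : h * n.+1 = c * h * q + d.+1 * h.
  by rewrite [in LHS](divn_eq n q) -/c -/d; ring.
have bq : d.+1 <= q by [].
rewrite vE; move: (count nb (iota (c * q) d.+1)) (C c) (C c.+1) r1 r2 le u0 u0' u1 u1' bq.
rewrite mulSn; move: (c * h) (d.+1) => t b w x y r1 r2 le u0 u0' u1 u1' bq.
have [e0 e0E] : exists e0, E * x = t + e0 by exists (E * x - t); lia.
have [e1 e1E] : exists e1, E * y = h + t + e1 by exists (E * y - (h + t)); lia.
have [r rE] : exists r, q = b + r by exists (q - b); lia.
have [S SE] : exists S, y = x + S by exists (y - x); lia.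
have bS : E * (b * S) + b * e0 = b * h + b * e1.
  suff : E * S + e0 = h + e1 by move=> eq; rewrite mulnCA -!mulnDr eq.
  by move: e1E; rewrite SE mulnDr e0E; lia.
rewrite SE addKn in r1 r2.
have {}r1 : E * (q * w) < E * (b * S) + E * q by rewrite -mulnDr ltn_pmul2l.
have {}r2 : E * (b * S) < E * (q * w) + E * q by rewrite -mulnDr ltn_pmul2l.
have E1 : E * q * (x + w) = t * q + (b * e0 + r * e0) + E * (q * w).
  have -> : E * q * (x + w) = E * x * q + E * (q * w) by ring.
  by rewrite e0E rE; ring.
have l0 : r * e0 <= r * E by rewrite leq_mul2l; apply/orP; right; lia.
have l1 : b * e1 <= b * E by rewrite leq_mul2l; apply/orP; right; lia.
have E2 : E * q = r * E + b * E by rewrite rE; ring.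
by rewrite E1; lia.
Qed.

(** Column discrepancy puts q l within q of C(c + 1), while C(c) < v <= C(c + 1) <= C(c) + q. *)
Lemma stack_height_bounds : q * l < v + 2 * q /\ v < q * l + q.
Proof.
have [] := hcol dq cP; rewrite -/stack_height -/l.
by have := level_row; have := levels_step c; lia.
Qed.

Lemma stack_height_gt0 : 0 < l.
Proof.
rewrite /l /stack_height -has_count; apply/hasP; exists c; last by rewrite -divn_eq.
by rewrite mem_iota /= add0n ltnSn.
Qed.

Lemma stack_height_le : q * l.-1 < C P.
Proof.
have [hl _] := hcol dq cP; have CP := levels_mono hC cP.
have := stack_height_gt0; move: hl; rewrite -/stack_height -/l.
by case: l => // l'; rewrite mulnS; lia.
Qed.

End Position.

(** Within a column the height increases strictly from one nonblank cell to the next. *)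
Lemma stack_height_inj n n' : nb n -> nb n' ->
  n %% q = n' %% q -> stack_height n = stack_height n' -> n = n'.
Proof.
suff lt m m' : nb m -> nb m' -> m %% q = m' %% q -> m %/ q < m' %/ q ->
    stack_height m < stack_height m'.
  move=> nbn nbn' dd hh; rewrite (divn_eq n q) (divn_eq n' q) dd; congr (_ * _ + _).
  case: (ltngtP (n %/ q) (n' %/ q)) => // [/(lt _ _ nbn nbn' dd)|/(lt _ _ nbn' nbn (esym dd))].
    by rewrite hh ltnn.
  by rewrite hh ltnn.
move=> nbm nbm' dd cc; rewrite /stack_height dd.
rewrite (leq_ltn_trans (count_iota_mono _ cc)) // count_iota_lt //.
by rewrite -divn_eq.
Qed.

End Rows.

(** * Rounding the blank levels *)

Lemma count_ord_compl (p : pred nat) b N : b <= N ->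
  count p (iota 0 b) + \sum_(d < N | d < b) ~~ p d = b.
Proof.
move=> bN; rewrite -(big_ord_widen _ (fun d => ~~ p d : nat) bN).
elim: b {bN} => [|b IHb]; first by rewrite big_ord0.
have -> : iota 0 b.+1 = iota 0 b ++ [:: b] by rewrite -addn1 iotaD.
by rewrite big_ord_recr count_cat /= addn0 addnACA IHb; case: (p b); rewrite /= ?addn1.
Qed.

(** Multiplying the discrepancy by [q] clears the denominators and leaves integer inequalities. *)
Lemma rounding_sum n b (t : 'I_n -> int) (f : 'I_n -> bool) (q : nat) : 0 < q ->
  (`|\sum_(d < n | (d < b)%N) ((t d)%:~R / q%:R - (f d)%:R : rat)| < 1)%R ->
  let s := (\sum_(d < n | (d < b)%N) t d)%R in
  let m := \sum_(d < n | d < b) f d in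
  (s < (q * m + q)%N%:Z)%R /\ ((q * m)%N%:Z < s + q%:Z)%R.
Proof.
move=> q0 + s m; rewrite sumrB -mulr_suml.
have -> : (\sum_(d < n | (d < b)%N) (t d)%:~R = s%:~R :> rat)%R.
  by rewrite /s rmorph_sum.
have -> : (\sum_(d < n | (d < b)%N) (f d)%:R = m%:R :> rat)%R.
  by rewrite /m natr_sum.
have q0' : (0 < q%:R :> rat)%R by rewrite ltr0n.
rewrite ltr_norml => /andP[h1 h2].
have e : (s%:~R = s%:~R / q%:R * q%:R :> rat)%R by rewrite divfK // gt_eqF.
split; rewrite -(ltr_int rat) ?rmorphD /= -!pmulrn ?natrD natrM; nra.
Qed.

(* ceil(b h / E_(i-1)), the number of nonblank integers in the first b rows. *)
Definition levels (a : seq nat) i b :=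
  (b * headprod a i + (2 ^ e_ a i.-1).-1) %/ 2 ^ e_ a i.-1.

Lemma levelsP a i b :
  b * headprod a i <= 2 ^ e_ a i.-1 * levels a i b < b * headprod a i + 2 ^ e_ a i.-1.
Proof.
rewrite /levels; have : 0 < 2 ^ e_ a i.-1 by rewrite expn_gt0.
move: (b * _) (2 ^ _) => t E E0.
have := divn_eq (t + E.-1) E; have := ltn_pmod (t + E.-1) E0; rewrite mulnC; lia.
Qed.

(** * From blank discrepancies to nonblank counts *)

Section Rounding.
Variables (a : seq nat) (F : roundings a) (i : nat).
Local Notation q := (2 ^ p_ a i).
Local Notation C := (levels a i).

Lemma blankE c d (cP : c < P_ a i) (dq : d < q) :
  blank F i (c * q + d).+1 = F i (Ordinal cP) (Ordinal dq).
Proof.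
apply/existsP/idP => [[c' /existsP[d' /andP[/eqP]]]|Fcd]; last first.
  by exists (Ordinal cP); apply/existsP; exists (Ordinal dq); rewrite /= addnS eqxx.
rewrite addnS => -[E]; have q0 := leq_ltn_trans (leq0n _) dq.
have cc : c = c'.
  have := congr1 (divn^~ q) E; rewrite /= !divnMDl // !divn_small ?ltn_ord //.
  by rewrite !addn0.
have dd : d = d' by move: E; rewrite -cc => /addnI.
by congr (F i _ _); apply/val_inj.
Qed.

(** C(b) is the ceiling of b times the ratio, so floor(b phi) = b C(1) - C(b). The blanks prescribed
    for a row are what its C(j + 1) - C(j) nonblanks leave of [q]. *)
Lemma s_levels j :
  (s_ a i j.+1 = q%:Z - (C j.+1)%:Z + (C j)%:Z)%R.
Proof.
set E := 2 ^ e_ a i.-1; set h := headprod a i.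
have E0 : (0 < E%:R :> rat)%R by rewrite ltr0n expn_gt0.
have rE : (ratio_ a i = h%:R / E%:R)%R by rewrite /ratio_ /E natrX.
have cl b : (b%:R * ratio_ a i <= (C b)%:R < b%:R * ratio_ a i + 1)%R.
  have /andP[h1 h2] := levelsP a i b.
  rewrite rE mulrA ler_pdivrMr // -ltrBlDr ltr_pdivlMr // mulrBl mul1r ltrBlDr.
  rewrite -!natrM -natrD ler_nat ltr_nat (mulnC (C b)).
  by rewrite /E /h; apply/andP; split; [exact: h1 | exact: h2].
have c1 : (Num.ceil (ratio_ a i) = (C 1)%:Z)%R.
  apply: ceil_def; have := cl 1; rewrite mul1r rmorphB /= -!pmulrn; lra.
have fl b : (Num.floor (b%:R * phi_ a i) = b%:Z * (C 1)%:Z - (C b)%:Z)%R.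
  apply: floor_def; have := cl b; rewrite /phi_ c1.
  rewrite !(rmorphD, rmorphN, rmorphM) /= -!pmulrn mulrBr; lra.
by rewrite /s_ !fl c1 intS succnK; ring.
Qed.

Hypothesis hF : is_rounding (T_ a i) (F i).
Local Notation nb := (fun n => ~~ blank F i n.+1).

Let q0 : 0 < q.
Proof. by rewrite expn_gt0. Qed.

(** The row condition on F(i) bounds blank counts; passing to the complement bounds nonblank
    counts. *)
Lemma rounding_row c b : c < P_ a i -> b <= q ->
  q * count nb (iota (c * q) b) < b * (C c.+1 - C c) + q /\
  b * (C c.+1 - C c) < q * count nb (iota (c * q) b) + q.
Proof.
move=> cP bq; have [->|b0] := posnP b; first by rewrite /= !muln0 !mul0n.
have [_ /(_ (Ordinal cP) b)] := hF; rewrite b0 bq => /(_ isT) + _ _.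
under eq_bigr => d _ do rewrite mxE -natrX.
move/(rounding_sum q0) => /= [].
rewrite -(big_ord_widen _ (fun=> s_ a i c.+1) bq) sumr_const card_ord s_levels.
have -> : \sum_(d < q | d < b) F i (Ordinal cP) d =
    \sum_(d < q | d < b) ~~ ~~ blank F i (c * q + d).+1.
  by apply: eq_bigr => d _; rewrite negbK blankE; congr (F i _ _ : nat); apply/val_inj.
have := @count_ord_compl (fun d => ~~ blank F i (c * q + d).+1) b q bq.
have -> : count (fun n => ~~ blank F i n.+1) (iota (c * q) b) =
    count (fun d => ~~ blank F i (c * q + d).+1) (iota 0 b).
  by rewrite -{1}[c * q]addn0 iotaDl count_map; apply: eq_count => d.
have := levels_mono (@levelsP a i) (leqnSn c).
move: (\sum_(_ | _) _) (count _ _) => m w le wm.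
have [S ->] : exists S, C c.+1 = C c + S by exists (C c.+1 - C c); lia.
rewrite -mulr_natr natz -wm addKn; nia.
Qed.

Lemma rounding_col d b : d < q -> b <= P_ a i ->
  q * count (fun c => ~~ blank F i (c * q + d).+1) (iota 0 b) < C b + q /\
  C b < q * count (fun c => ~~ blank F i (c * q + d).+1) (iota 0 b) + q.
Proof.
move=> dq bP; have [->|b0] := posnP b.
  by rewrite /= muln0 (levels0 (@levelsP a i)) add0n.
have [_ _ /(_ (Ordinal dq) b)] := hF; rewrite b0 bP => /(_ isT) + _.
under eq_bigr => c _ do rewrite mxE -natrX.
move/(rounding_sum q0) => /= [].
rewrite -(big_ord_widen _ (fun c => s_ a i c.+1) bP).
(* The prescribed blanks telescope over the first [b] rows. *)
have -> : (\sum_(c < b) s_ a i c.+1 = (b * q)%N%:Z - (C b)%:Z)%R.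
  elim: (b) => [|b' IHb]; first by rewrite big_ord0 mul0n (levels0 (@levelsP a i)).
  by rewrite big_ord_recr /= IHb s_levels mulSn PoszD; ring.
have -> : \sum_(c < P_ a i | c < b) F i c (Ordinal dq) =
    \sum_(c < P_ a i | c < b) ~~ ~~ blank F i (c * q + d).+1.
  by apply: eq_bigr => c _; rewrite negbK blankE; congr (F i _ _ : nat); apply/val_inj.
have := @count_ord_compl (fun c => ~~ blank F i (c * q + d).+1) b (P_ a i) bP.
move: (\sum_(_ | _) _) (count _ _) => m w wm.
rewrite -wm; nia.
Qed.
End Rounding.

(** * One stage of the construction *)

Lemma up_log2_lt n : 0 < n -> 2 ^ up_log 2 n < 2 * n.
Proof.
case: n => [|[|n]] // _; have := @up_log_gtn 2 n.+2 isT isT.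
case: (up_log 2 n.+2) => [|e]; first by rewrite expn0; lia.
by rewrite expnS ltn_pmul2l.
Qed.

(** With X = n + 1 and X' = n' + 1, the bounds multiplied by [q] give |h X' - h X - q B| < 7 E q <=
    14 h. If B = m h, then q B is h times the shift m q; if B <= E, then q B <= E q <= 2 h, which
    raises 14 to 16. *)
Lemma cyc_close_position E q h B v v' n n' : 0 < q -> E * q <= 2 * h ->
  h * n.+1 < E * q * v + E * q -> E * q * v < h * n.+1 + 2 * (E * q) ->
  h * n'.+1 < E * q * v' + E * q -> E * q * v' < h * n'.+1 + 2 * (E * q) ->
  E * v' <= B + E * v + 4 * E -> B + E * v <= E * v' + 4 * E ->
  h %| B \/ B <= E -> cyc_close q 17 (n %% q).+1 (n' %% q).+1.
Proof.
move=> q0 Qh n1 n2 n1' n2' v1 v2 hB.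
suff [m [le1 le2]] : exists m, n.+1 + m * q < n'.+1 + 16 /\ n'.+1 < n.+1 + m * q + 16.
  (* The quotients turn the remainders back into the full positions. *)
  exists (n %/ q + m), (n' %/ q).
  have E1 := divn_eq n q; have E2 := divn_eq n' q.
  by rewrite mulnDl; lia.
have h0 : 0 < h by lia.
have v1q := leq_mul (leqnn q) v1; have v2q := leq_mul (leqnn q) v2.
rewrite !mulnDr !(mulnCA q) !mulnA in v1q v2q.
case: hB => [/dvdnP[m BE]|BE].
  have E3 : h * (m * q) = q * B by rewrite BE; ring.
  by exists m; split; rewrite -(ltn_pmul2l h0) !mulnDr E3; lia.
have BEq := leq_mul (leqnn q) BE.
by exists 0; rewrite mul0n addn0; split; rewrite -(ltn_pmul2l h0) !mulnDr; lia.
Qed.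

(** * Invariants carried from f_i to f_(i+1) *)

Section Step.
Variables (k : nat) (a : k.-tuple nat).
Hypotheses (hk : 2 <= k) (ha : forall i : 'I_k, 2 ^ 22 <= tnth a i).

Let a_gt0 (i : 'I_k) : 0 < tnth a i.
Proof. by apply: leq_trans (ha i); rewrite expn_gt0. Qed.

Lemma headprod_le i : headprod a i <= 2 ^ e_ a i.
Proof. exact: up_logP. Qed.

Lemma headprod_gt i : 2 ^ e_ a i < 2 * headprod a i.
Proof. exact/up_log2_lt/headprod_gt0. Qed.

(** With h_i = a_1 ... a_i: 2^(e_(i-1) + 22) < 2 h_(i-1) 2^22 <= 2 h_i <= 2^(e_i + 1). *)
Lemma e_step i : 0 < i <= k -> e_ a i.-1 + 22 <= e_ a i.
Proof.
move=> ik; have lt : i.-1 < k by lia.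
have h1 := headprod_gt i.-1; have h2 := headprod_le i.
have h3 := headprodS a hk lt; rewrite prednK in h3; last by lia.
have h4 : 2 ^ 22 <= coord a i by have := ha (Ordinal lt); rewrite (tnth_nth 0).
rewrite -ltnS -(ltn_exp2l (m := 2)) // expnD (expnS 2 (e_ a i)).
apply: (@leq_trans (2 * headprod a i.-1 * 2 ^ 22)).
  by rewrite ltn_pmul2r ?expn_gt0.
rewrite -mulnA leq_pmul2l //; apply: leq_trans h2.
by rewrite h3 leq_mul2l h4 orbT.
Qed.

Lemma p_ge22 i : 0 < i <= k -> 22 <= p_ a i.
Proof. by move=> /e_step; rewrite /p_; lia. Qed.

Lemma expn_e i : 0 < i <= k -> 2 ^ e_ a i.-1 * 2 ^ p_ a i = 2 ^ e_ a i.
Proof. by move=> /e_step le; rewrite -expnD /p_ subnKC //; lia. Qed.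

(* The fourth clause makes [stack] count every nonblank cell below a point. *)
Definition stage_inv i (f : grid a -> seq nat) : Prop :=
  [/\ injective f, forall x, size (f x) = i,
      forall x, 0 < coord (f x) i /\ 2 ^ e_ a i.-1 * (coord (f x) i).-1 < headprod a k,
      forall x v, 0 < v <= coord (f x) i -> exists x', f x' = rcons (take i.-1 (f x)) v
    & forall x j, 0 < j < i -> 0 < coord (f x) j <= 2 ^ p_ a j].

(* To be used with B = D a_1, for an edge raising the chain index by D. *)
Definition stage_near i (f : grid a -> seq nat) (x x' : grid a) (B : nat) : Prop :=
  [/\ forall j, 0 < j < i -> cyc_close (2 ^ p_ a j) 17 (coord (f x) j) (coord (f x') j),
      2 ^ e_ a i.-1 * coord (f x') i <=
        B + 2 ^ e_ a i.-1 * coord (f x) i + 4 * 2 ^ e_ a i.-1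
    & B + 2 ^ e_ a i.-1 * coord (f x) i <=
        2 ^ e_ a i.-1 * coord (f x') i + 4 * 2 ^ e_ a i.-1].

Variables (F : roundings a) (i : nat) (f : grid a -> seq nat).
Hypotheses (ik : 2 <= i < k) (hF : is_rounding (T_ a i) (F i)).
Hypothesis finv : stage_inv i f.

Local Notation q := (2 ^ p_ a i).
Local Notation E := (2 ^ e_ a i.-1).
Local Notation P := (P_ a i).
Local Notation C := (levels a i).
Local Notation h := (headprod a i).
Local Notation nb := (fun n => ~~ blank F i n.+1).
Local Notation height := (stack_height nb q).

Let q0 : 0 < q. Proof. by rewrite expn_gt0. Qed.
Let i0 : 0 < i. Proof. by case/andP: ik => /ltnW. Qed.
Let E0 : 0 < E. Proof. by rewrite expn_gt0. Qed.
Let Eq : E * q = 2 ^ e_ a i. Proof. by apply: expn_e; lia. Qed.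
Let hEq : h <= E * q. Proof. by rewrite Eq headprod_le. Qed.
Let hC := @levelsP a i.
Let hrow := rounding_row hF.
Let hcol := rounding_col hF.

Let total : E * C P < headprod a k + E.
Proof.
by have /andP[_] := hC P; rewrite (mulnC P h) headprod_P.
Qed.

Let total_ge : headprod a k <= E * C P.
Proof.
by have /andP[+ _] := hC P; rewrite (mulnC P h) headprod_P.
Qed.

(** This number is u_i, since h P_i = |V(G)|. *)
Lemma size_nonblanks : count nb (iota 0 (P * q)) = C P.
Proof. exact: (rank_row q0 E0 hEq hC hrow). Qed.

Lemma nonblanksE : nonblanks F i = [seq n.+1 | n <- filter nb (iota 0 (P * q))].
Proof. by rewrite /nonblanks (iotaDl 1 0) filter_map. Qed.

(* Counted from 0: the v-th nonblank integer is [(slot v).+1]. *)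
Definition slot v := nth 0 (filter nb (iota 0 (P * q))) v.-1.

Lemma slotP v : 0 < v <= C P ->
  [/\ slot v < P * q, nb (slot v) & v = (count nb (iota 0 (slot v))).+1].
Proof.
move=> vP; have lt : v.-1 < count nb (iota 0 (P * q)) by rewrite size_nonblanks; lia.
have [nP nbn ->] := nth_filter_iotaP lt; rewrite prednK //.
by case/andP: vP.
Qed.

Lemma slotK n : n < P * q -> nb n -> slot (count nb (iota 0 n)).+1 = n.
Proof. exact: nth_filter_iota. Qed.

(** E (v - 1) < |V(G)| <= E C(P). Hence the v-th nonblank integer exists, and [nth] does not fall
    back on its default. *)
Lemma level_le x : 0 < coord (f x) i <= C P.
Proof.
have [_ _ /(_ x)[v0 vlt] _ _] := finv; rewrite v0 /=.
have : E * (coord (f x) i).-1 < E * C P by apply: leq_trans total_ge.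
by rewrite ltn_pmul2l //; lia.
Qed.

Definition slot_of x := slot (coord (f x) i).

Lemma slot_ofP x : [/\ slot_of x < P * q, nb (slot_of x)
  & coord (f x) i = (count nb (iota 0 (slot_of x))).+1].
Proof. exact/slotP/level_le. Qed.

Lemma f_split x : f x = rcons (take i.-1 (f x)) (coord (f x) i).
Proof.
have [_ /(_ x) sz _ _ _] := finv.
by rewrite /coord -take_nth ?sz ?prednK // take_oversize ?sz.
Qed.

Lemma inflateE x : inflate F i (f x) = rcons (take i.-1 (f x)) (slot_of x).+1.
Proof.
have [lt _ _] := slot_ofP x; have lv := level_le x.
rewrite /inflate /coord nonblanksE (nth_map 0) //.
by rewrite size_filter size_nonblanks -/(coord (f x) i); lia.
Qed.

Lemma size_pre x : size (take i.-1 (f x)) = i.-1.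
Proof. by have [_ /(_ x) sz _ _ _] := finv; rewrite size_takel // sz leq_pred. Qed.

(** The points counted by [stack] are image points with the prefix of [f x], in the same column and
    no lower. Downward closure makes them fill every nonblank cell there, so their number is the
    height. *)
Lemma next_mapE x : next_map F i f x =
  rcons (rcons (take i.-1 (f x)) (slot_of x %% q).+1) (height (slot_of x)).
Proof.
have takeE z n : take i.-1 (rcons (take i.-1 (f z)) n) = take i.-1 (f z).
  by rewrite -cats1 take_size_cat ?size_pre.
have coordE z n : coord (rcons (take i.-1 (f z)) n) i = n.
  by rewrite /coord nth_rcons size_pre ltnn eqxx.
rewrite /next_map /stack inflateE takeE coordE subn1 /=.
set n := slot_of x; set S := undup _.
have -> : (n.+1 + q - 1) %/ q = (n %/ q).+1.
  by rewrite addSn subn1 /= divnDr ?dvdnn // divnn q0 addn1.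
congr rcons; rewrite -size_filter.
(* The nonblank cells of the column down to [n], to be matched with the points counted by
   [stack]. *)
pose t := [seq rcons (take i.-1 (f x)) (c * q + n %% q).+1 |
  c <- filter (fun c => nb (c * q + n %% q)) (iota 0 (n %/ q).+1)].
have -> : height n = size t by rewrite size_map size_filter.
have [nP nbn vE] := slot_ofP x; rewrite -/n in nP nbn vE.
apply/perm_size/uniq_perm.
- by rewrite filter_uniq // undup_uniq.
- rewrite map_inj_uniq ?filter_uniq ?iota_uniq // => c c' /rcons_inj[] /addIn /eqP.
  by rewrite eqn_pmul2r // => /eqP.
move=> z; rewrite mem_filter mem_undup.
apply/andP/mapP => [[/and3P[z1 z2 z3] /codomP[x' zE]]|].
  rewrite zE inflateE takeE coordE in z1 z2 z3 *.
  have [n'P nbn' vE'] := slot_ofP x'.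
  move: z2; rewrite -(addn1 (slot_of x')) -(addn1 n) eqn_modDr => /eqP z2.
  exists (slot_of x' %/ q); last by rewrite (eqP z1) -z2 -divn_eq addn1.
  rewrite mem_filter -z2 -divn_eq nbn' mem_iota /= add0n.
  by rewrite ltn_divLR.
case=> c; rewrite mem_filter mem_iota /= add0n ltnS => /andP[nbc cn] ->.
have cqn : c * q + n %% q <= n by rewrite [leqRHS](divn_eq n q) leq_add2r leq_mul2r cn orbT.
have [_ _ _ down _] := finv.
(* A cell above [n] has a smaller rank, so downward closure supplies a vertex placed there. *)
have [|x' fx'] := down x (count nb (iota 0 (c * q + n %% q))).+1.
  by rewrite vE /= ltnS count_iota_mono.
have cx' : coord (f x') i = (count nb (iota 0 (c * q + n %% q))).+1.
  by rewrite fx' coordE.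
have px' : take i.-1 (f x') = take i.-1 (f x) by rewrite fx' takeE.
have sx' : slot_of x' = c * q + n %% q.
  by rewrite /slot_of cx' slotK // (leq_ltn_trans cqn).
split; last first.
  by apply/codomP; exists x'; rewrite inflateE px' sx'.
rewrite takeE coordE eqxx /= -(addn1 (_ + _)) -(addn1 n) eqn_modDr modnMDl modn_mod eqxx /=.
by rewrite addn1 mulSnr -addnS leq_add ?leq_mul2r ?cn ?orbT // ltn_pmod.
Qed.
Lemma take_next_map x :
  take i (next_map F i f x) = rcons (take i.-1 (f x)) (slot_of x %% q).+1.
Proof.
by rewrite next_mapE -[rcons _ (height _)]cats1 take_size_cat // size_rcons size_pre prednK.
Qed.

Lemma coord_next_pre x j : 0 < j < i -> coord (next_map F i f x) j = coord (f x) j.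
Proof.
move=> /andP[j0 ji]; have lt : j.-1 < i.-1 by rewrite -ltnS !prednK.
by rewrite next_mapE /coord !nth_rcons size_rcons size_pre (leqW lt) lt nth_take.
Qed.

Lemma coord_next_col x : coord (next_map F i f x) i = (slot_of x %% q).+1.
Proof.
by rewrite next_mapE /coord !nth_rcons size_rcons size_pre ltnSn ltnn eqxx.
Qed.

Lemma coord_next_last x : coord (next_map F i f x) i.+1 = height (slot_of x).
Proof. by rewrite next_mapE /coord succnK nth_rcons size_rcons size_pre prednK // ltnn eqxx. Qed.

Lemma stage_inv_step : stage_inv i.+1 (next_map F i f).
Proof.
have [f_inj _ _ down bnd] := finv; split.
- move=> x x'; rewrite !next_mapE => /rcons_inj[/rcons_inj[px mx] hx].
  have [_ nbn vE] := slot_ofP x; have [_ nbn' vE'] := slot_ofP x'.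
  have sE := stack_height_inj nbn nbn' mx hx.
  by apply: f_inj; rewrite f_split [RHS]f_split px vE vE' sE.
- by move=> x; rewrite next_mapE !size_rcons size_pre prednK.
- move=> x; rewrite coord_next_last; have [nP nbn _] := slot_ofP x.
  rewrite (stack_height_gt0 q nbn); split=> //.
  rewrite succnK -Eq -mulnA.
  (* E q (l - 1) + E <= E C(P) < |V(G)| + E. *)
  have := leq_mul (leqnn E) (stack_height_le q0 E0 hEq hC hrow hcol nP nbn).
  by rewrite mulnS; have := total; lia.
- move=> x v; rewrite coord_next_last => /andP[v0 vh].
  have vlt : v.-1 < height (slot_of x) by rewrite prednK.
  (* [c] is the row of the v-th nonblank cell of the column; the old downward closure provides a
     vertex in that cell. *)
  have [] := nth_filter_iotaP vlt; set c := nth _ _ _ => cn nbc cv.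
  have [nP nbn vE] := slot_ofP x.
  set n := c * q + slot_of x %% q in nbc.
  have nn : n <= slot_of x.
    by rewrite [leqRHS](divn_eq _ q) leq_add2r leq_mul2r -ltnS cn orbT.
  have [|x' fx'] := down x (count nb (iota 0 n)).+1.
    by rewrite vE /= ltnS count_iota_mono.
  exists x'.
  have px' : take i.-1 (f x') = take i.-1 (f x).
    by rewrite fx' -cats1 take_size_cat ?size_pre.
  have sx' : slot_of x' = n.
    rewrite /slot_of fx' /coord nth_rcons size_pre ltnn eqxx slotK //.
    exact: leq_ltn_trans nP.
  rewrite succnK take_next_map next_mapE px' sx' /n modnMDl modn_mod; congr rcons.
  rewrite /stack_height modnMDl modn_mod divnMDl // divn_small ?ltn_pmod // addn0.
  rewrite -[c.+1]addn1 iotaD count_cat cv /= nbc addn0 addn1 prednK //.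
- move=> x j /andP[j0]; rewrite ltnS leq_eqVlt => /predU1P[->|ji].
    by rewrite coord_next_col ltn_pmod.
  by rewrite coord_next_pre ?j0 // bnd ?j0.
Qed.

(** Passing from v to l, which is v / q up to errors -1 and 2, adds at most 3 E q to the old error 4
    E. As 4 E <= E q, the total is at most 4 E q, so the constant 4 is preserved. *)
Lemma stage_near_step x x' B : stage_near i f x x' B -> h %| B \/ B <= E ->
  stage_near i.+1 (next_map F i f) x x' B.
Proof.
move=> [cl v1 v2] hB.
have [nP nbn vE] := slot_ofP x; have [nP' nbn' vE'] := slot_ofP x'.
have [p1 p2] := level_position q0 E0 hEq hC hrow nP nbn.
have [p1' p2'] := level_position q0 E0 hEq hC hrow nP' nbn'.
have [l1 l2] := stack_height_bounds q0 E0 hEq hC hrow hcol nP nbn.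
have [l1' l2'] := stack_height_bounds q0 E0 hEq hC hrow hcol nP' nbn'.
rewrite -!vE -!vE' in p1 p2 p1' p2' l1 l2 l1' l2'.
have q4 : 4 * E <= E * q.
  rewrite mulnC leq_mul2l (_ : 4 = 2 ^ 2) // leq_exp2l // (leq_trans _ (p_ge22 _)) ?orbT //.
  by rewrite i0 /=; case/andP: ik => _ /ltnW.
have hgt : E * q <= 2 * h by rewrite Eq ltnW ?headprod_gt.
split.
- move=> j /andP[j0]; rewrite ltnS leq_eqVlt => /predU1P[->|ji].
    by rewrite !coord_next_col; apply: (cyc_close_position q0 hgt p1 p2 p1' p2' v1 v2 hB).
  by rewrite !coord_next_pre ?j0 //; apply: cl; rewrite j0.
- rewrite !coord_next_last succnK -Eq.
  have := leq_mul (leqnn E) l1'; have := leq_mul (leqnn E) l2.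
  by rewrite !mulnS !mulnDr !mulnA; lia.
rewrite !coord_next_last succnK -Eq.
have := leq_mul (leqnn E) l1; have := leq_mul (leqnn E) l2'.
by rewrite !mulnS !mulnDr !mulnA; lia.
Qed.

End Step.

(** * The embedding *)

Lemma flatten_map_inj (T : eqType) (g g' : nat -> seq T) (s : seq nat) :
  (forall j, size (g j) = size (g' j)) ->
  flatten [seq g j | j <- s] = flatten [seq g' j | j <- s] ->
  forall j, j \in s -> g j = g' j.
Proof.
move=> sz; elim: s => //= i s IHs /eqP; rewrite eqseq_cat //.
move=> /andP[/eqP gi /eqP /IHs gs] j.
by rewrite inE => /predU1P[->|/gs].
Qed.

Lemma ham_flatten d (g g' : nat -> seq bool) (s : seq nat) :
  (forall j, size (g j) = size (g' j)) -> (forall j, j \in s -> ham (g j) (g' j) <= d) ->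
  ham (flatten [seq g j | j <- s]) (flatten [seq g' j | j <- s]) <= d * size s.
Proof.
move=> sz; elim: s => [|i s IHs] le /=; first by rewrite hamxx.
rewrite ham_cat // mulnS leq_add ?le ?mem_head //.
by apply: IHs => j js; rewrite le // inE js orbT.
Qed.

Section Embedding.
Variables (k : nat) (a : k.-tuple nat).
Hypotheses (hk : 2 <= k) (ha : forall i : 'I_k, 2 ^ 22 <= tnth a i).

Let a_gt0 (i : 'I_k) : 0 < tnth a i.
Proof. by apply: leq_trans (ha i); rewrite expn_gt0. Qed.

Let A0 : 0 < coord a 1. Proof. by apply: (coord_gt0 hk a_gt0); rewrite /= ltnW. Qed.
Let Am : coord a 1 <= 2 ^ e_ a 1.
Proof. by rewrite -(headprod1 a hk) headprod_le. Qed.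
Let m2A : 2 ^ e_ a 1 < 2 * coord a 1.
Proof. by rewrite -(headprod1 a hk) headprod_gt. Qed.

Lemma p1E : p_ a 1 = e_ a 1.
Proof. by rewrite /p_ {2}/e_ /headprod take0 big_nil subn0. Qed.

Lemma f2_shape (x : grid a) : exists z v, f2 x = [:: z; v].
Proof. by rewrite /f2 /chain_map; eexists; eexists. Qed.

Lemma stage_inv_f2 : stage_inv 2 (@f2 k a).
Proof.
have m0 : 0 < 2 ^ e_ a 1 by rewrite expn_gt0.
have shape (x : grid a) : exists z v, [/\ f2 x = [:: z; v],
    chain_map a (row_index x) (chain_index x) = [:: z; v],
    0 < z <= 2 ^ e_ a 1, 0 < v & 2 ^ e_ a 1 * v.-1 < coord a 1 * chain_index x].
  have [z [v fx]] := f2_shape x; have E := fx; rewrite f2E // in E.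
  have rb := row_index_bounds hk x; have y0 := chain_index_gt0 x.
  have [v0 _ /andP[zc cz]] := chain_map_range (erefl _) (erefl _) A0 Am m2A rb y0 E.
  have [vy _ _ _] := chain_map_bounds (erefl _) (erefl _) A0 Am m2A rb y0 E.
  exists z, v; split=> //; last first.
    by move: vy; rewrite -{1}(prednK v0) mulnS addnC ltn_add2r.
  rewrite (leq_ltn_trans _ zc) //= (leq_trans cz) //.
  have <- := c_top (erefl _) (erefl _) A0 Am m2A v0.
  by apply: c_mono; case/andP: rb.
have hP : coord a 1 * P_ a 1 = headprod a k by rewrite -(headprod1 a hk) headprod_P.
split.
- move=> x x'; rewrite !f2E // => E.
  have [] := chain_map_inj (erefl _) (erefl _) A0 Am m2A
    (row_index_bounds hk x) (row_index_bounds hk x') (chain_index_gt0 x) (chain_index_gt0 x') E.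
  exact: grid_index_inj.
- by move=> x; have [z [v ->]] := f2_shape x.
- move=> x; have [z [v [-> _ _ v0 lt]]] := shape x; split=> //.
  rewrite -hP; apply: leq_trans lt _.
  by rewrite leq_mul2l (chain_index_le hk a_gt0 x) orbT.
- move=> x v'; have [z [v [-> E zm v0 lt]]] := shape x.
  rewrite /coord /= => /andP[v'0]; rewrite leq_eqVlt => /predU1P[->|v'v].
    by exists x; rewrite f2E.
  have [i [y [ia /andP[Ny yN] E']]] := chain_map_surj (erefl _) (erefl _) A0 Am m2A zm v'0.
  (* The point (z, v') may lie on another chain, but v' <= v - 1 gives y <= N_i(v-1) <=
     [chain_index x] <= P_1, so it comes from a vertex of the grid. *)
  have [x' [rx cx]] : exists x' : grid a, row_index x' = i /\ chain_index x' = y.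
    apply: (grid_index_surj hk a_gt0) => //; rewrite (leq_ltn_trans _ Ny) //=.
    apply: leq_trans (chain_index_le hk a_gt0 x); apply: leq_trans yN _.
    have v'1 : v' <= v.-1 by rewrite -ltnS prednK.
    apply: leq_trans (N_mono a i v'1) _.
    have [Nb _] := N_bounds (erefl _) (erefl _) A0 Am m2A v.-1 ia.
    rewrite -ltnS -(ltn_pmul2l A0) mulnS addnC.
    by apply: leq_trans Nb _; rewrite leq_add2r ltnW.
  by exists x'; rewrite f2E // rx cx E'.
move=> x j j2; have -> : j = 1 by lia.
have [z [v [-> _ zm _ _]]] := shape x; by rewrite p1E.
Qed.

Lemma stage_near_f2 (x x' : grid a) D :
  row_index x' = row_index x \/ row_index x' = (row_index x).+1 ->
  chain_index x' = chain_index x + D ->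
  stage_near 2 (@f2 k a) x x' (D * coord a 1).
Proof.
move=> rx cx; have [z [v E]] := f2_shape x; have [z' [v' E']] := f2_shape x'.
have := (E, E'); rewrite !f2E // cx => -[E1 E1'].
have [cl v1 v2] := chain_map_near (erefl _) (erefl _) A0 Am m2A
  (row_index_bounds hk x) (row_index_bounds hk x') rx (chain_index_gt0 x) E1 E1'.
rewrite /stage_near E E' /coord /=; split=> // j j2.
have -> : j = 1 by lia.
by rewrite p1E; exact: cl.
Qed.

Variable F : roundings a.
Hypothesis hF : forall i : nat, 2 <= i < k -> is_rounding (T_ a i) (F i).

Lemma f_step i : 2 <= i -> f_ F i.+1 = next_map F i (f_ F i).
Proof. by move=> i2; rewrite /= i2. Qed.

Lemma stage_inv_f i : 2 <= i <= k -> stage_inv i (f_ F i).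
Proof.
move=> /andP[]; elim: i => // i IHi; rewrite leq_eqVlt => /predU1P[[<-] _|i2 ik].
  exact: stage_inv_f2.
have i2k : 2 <= i < k by rewrite -ltnS i2.
rewrite f_step //; apply: stage_inv_step => //; first exact: hF.
by apply: IHi => //; apply: ltnW.
Qed.

Lemma up_close (x x' : grid a) t : grid_up x x' t -> forall j, 0 < j <= k ->
  cyc_close (2 ^ p_ a j) 17 (coord (f_ F k x) j) (coord (f_ F k x') j).
Proof.
move=> /(grid_up_index hk)[D [rx cx DB]].
(* If D a_1 = a_1 ... a_n, the first case is n >= i and the second n <= i - 1. *)
have dvd_or_le i : headprod a i %| D * coord a 1 \/ D * coord a 1 <= 2 ^ e_ a i.-1.
  case: DB => [->|[n nk ->]]; first by left; rewrite dvdn0.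
  have [le|lt] := leqP i n; first by left; apply: headprod_dvd.
  right; apply: leq_trans (headprod_le a i.-1).
  by rewrite dvdn_leq ?headprod_gt0 // headprod_dvd; lia.
have near i : 2 <= i <= k -> stage_near i (f_ F i) x x' (D * coord a 1).
  move=> /andP[]; elim: i => // i IHi; rewrite leq_eqVlt => /predU1P[[<-] _|i2 ik].
    exact: stage_near_f2.
  have i2k : 2 <= i < k by rewrite -ltnS i2.
  rewrite f_step //; apply: stage_near_step => //; first exact: hF.
  - by apply: stage_inv_f; lia.
  by apply: IHi => //; apply: ltnW.
have [|cl v1 v2] := near k; first by rewrite hk leqnn.
move=> j /andP[j0]; rewrite leq_eqVlt => /predU1P[->|jk]; last by apply: cl; rewrite j0.
(* As n < k, the last coordinate changes by at most 1 + 4, without wrapping around. *)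
have Ble : D * coord a 1 <= 2 ^ e_ a k.-1.
  case: DB => [->//|[n nk ->]]; apply: leq_trans (headprod_le a k.-1).
  by rewrite dvdn_leq ?headprod_gt0 // headprod_dvd; lia.
exists 0, 0; rewrite !mul0n !addn0.
have E0 : 0 < 2 ^ e_ a k.-1 by rewrite expn_gt0.
by split; rewrite -(leq_pmul2l E0) mulnDr; lia.
Qed.

(** For j = k: 2^(e_(k-1)) (v - 1) < |V(G)| <= 2^(e_k) = 2^(e_(k-1)) 2^(p_k). Earlier coordinates
    are bounded by the invariant. *)
Lemma f_bounds (x : grid a) j : 0 < j <= k -> 0 < coord (f_ F k x) j <= 2 ^ p_ a j.
Proof.
have [|_ _ /(_ x)[v0 vlt] _ bnd] := @stage_inv_f k; first by rewrite hk leqnn.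
move=> /andP[j0]; rewrite leq_eqVlt => /predU1P[->|jk]; last by apply: bnd; rewrite j0.
rewrite v0 /=; have := leq_trans vlt (headprod_le a k).
rewrite -(expn_e hk ha (i := k)) ?leqnn ?andbT ?(ltnW hk) // ltn_pmul2l ?expn_gt0 //.
by rewrite prednK.
Qed.

Variable L : forall t : nat, cube t -> nat.
Hypothesis hL : forall t : nat, 22 <= t -> is_labelling (@L t).

Let all_a : all (leq 1) a.
Proof. by apply/allP => m /tnthP[i ->]; apply: a_gt0. Qed.

Let label x j := label_inv (@L (p_ a j)) (coord (f_ F k x) j).

Lemma labelK x j : 0 < j <= k -> L (label x j) = coord (f_ F k x) j.
Proof.
move=> jk; have p22 := p_ge22 hk ha jk.
apply: label_invK; last exact: f_bounds; last exact: hL.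
by apply: leq_trans p22.
Qed.

Lemma embedding_inj : injective (embedding F L).
Proof.
move=> x x' /(congr1 val) /=; rewrite !val_embedding // /label_concat => E.
have sz j : size (label x j) = size (label x' j) by rewrite !size_tuple.
have [|f_inj fsz _ _ _] := @stage_inv_f k; first by rewrite hk leqnn.
apply/f_inj/(@eq_from_nth _ 0) => [|j]; rewrite !fsz // => jk.
have jk1 : 0 < j.+1 <= k by [].
rewrite -[LHS](labelK x jk1) -[RHS](labelK x' jk1); congr L; apply/val_inj.
by apply: (flatten_map_inj sz E); rewrite mem_iota add1n.
Qed.

Lemma label_near x x' t : grid_up x x' t ->
  forall j, 0 < j <= k -> ham (label x j) (label x' j) <= 3.
Proof.
move=> xx' j jk; have p22 := p_ge22 hk ha jk.
apply: (labelling_close _ (hL p22)); first exact: leq_trans p22.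
by rewrite !labelK //; apply: up_close xx' _ jk.
Qed.

Lemma ham_embedding x x' : grid_adj x x' ->
  ham (tval (embedding F L x)) (tval (embedding F L x')) <= 3 * k.
Proof.
move=> adj; have [t xx'] := grid_adj_up hk adj.
rewrite !val_embedding // -[leqRHS](congr1 (muln 3) (size_iota 1 k)).
apply: (@ham_flatten 3 (label x) (label x')) => j; first by rewrite !size_tuple.
rewrite mem_iota add1n ltnS => jk.
(* An edge oriented from [x'] to [x] is covered by the symmetry of the Hamming distance. *)
by case: xx' => /label_near/(_ j jk) //; rewrite hamC ?size_tuple.
Qed.

End Embedding.

Theorem theorem6p3 (k : nat) (a : k.-tuple nat)
    (F : roundings a) (L : forall t : nat, cube t -> nat)
    (hk : 2 <= k)
    (ha : forall i : 'I_k, 2 ^ 22 <= tnth a i)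
    (hF : forall i : nat, 2 <= i < k -> is_rounding (T_ a i) (F i))
    (hL : forall t : nat, 22 <= t -> is_labelling (L t)) :
  injective (embedding F L) /\
  dilation (@grid_adj k a) (@cube_adj (up_log 2 #|grid a|)) (embedding F L)
    <= 3 * k.
Proof.
split; first exact: embedding_inj.
apply/bigmax_leqP => -[x x'] /= /(ham_embedding hk ha hF hL).
by apply: leq_trans; apply: gdist_cube.
Qed.
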